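(* Let $H:\mathbb{R}^n\times\mathbb{R}^n\to\mathbb{R}$ satisfy: $p\mapsto H(x,p)$ is convex for every $x\in\mathbb{R}^n$; $x\mapsto H(x,p)$ is concave for every $p\in\mathbb{R}^n$; and $|H(x,p)|\leqslant M(1+|x|)(1+|p|)$ for all $x,p\in\mathbb{R}^n$ and some $M\geqslant0$. If an initial function $g_0:\mathbb{R}^n\to\mathbb{R}$ is convex, then the unique forward viscosity solution $u:[0,\infty)\times\mathbb{R}^n\to\mathbb{R}$ of $\nabla_tu+H(x,\nabla_xu)=0$ satisfying $u(0,\cdot)=g_0(\cdot)$ is a bilateral viscosity solution. Consequently, every convex initial function is reconstructible in every time $T>0$.
   Context: For continuous $u$ and an interior point $(t,x)$, $\partial_+u(t,x)$ (resp. $\partial_-u(t,x)$) is the set of $\nabla\varphi(t,x)$ over $C^1$ functions $\varphi$ such that $u-\varphi$ has a local max (resp. min) at $(t,x)$. $u$ is a forward viscosity solution if at every interior point $u_t+H(x,u_x)\leqslant0$ for $(u_t,u_x)\in\partial_+u$ and $\geqslant0$ for $(u_t,u_x)\in\partial_-u$; $w$ is a backward viscosity solution if $w_t+H(x,w_x)\geqslant0$ on $\partial_+w$ and $\leqslant0$ on $\partial_-w$; a bilateral viscosity solution is one that is both forward and backward. $g_0\in C(\mathbb{R}^n,\mathbb{R})$ is reconstructible in time $T$ if $g_0=w(0,\cdot)$ where $w$ is the unique backward viscosity solution on $[0,T]\times\mathbb{R}^n$ with $w(T,\cdot)=u(T,\cdot)$ and $u$ is the unique forward viscosity solution on $[0,T]\times\mathbb{R}^n$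 with $u(0,\cdot)=g_0$. *)

(* Defs.v *)
From HB Require Import structures.
From mathcomp Require Import all_boot all_order all_algebra.
From mathcomp Require Import all_classical all_reals all_analysis.
Set Implicit Arguments. Unset Strict Implicit. Unset Printing Implicit Defensive.
Import Order.TTheory GRing.Theory Num.Theory.
Import numFieldNormedType.Exports.
Local Open Scope classical_set_scope.
Local Open Scope ring_scope.

Section Defs.
Variables (R : realType) (n : nat).
Local Notation V := 'rV[R]_n.

Definition enorm (x : V) : R := Num.sqrt (\sum_(i < n) (x ord0 i) ^+ 2).

Definition ebasis (i : 'I_n) : V := delta_mx ord0 i.

Definition convex_fun (f : V -> R) : Prop :=
  forall (x y : V) (l : R), 0 <= l -> l <= 1 ->
    f (l *: x + (1 - l) *: y) <= l * f x + (1 - l) * f y.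

Definition concave_fun (f : V -> R) : Prop :=
  forall (x y : V) (l : R), 0 <= l -> l <= 1 ->
    l * f x + (1 - l) * f y <= f (l *: x + (1 - l) *: y).

Definition dt (phi : R -> V -> R) (t : R) (x : V) : R :=
  'D_1 (fun s : R => phi s x) t.
Definition dxi (phi : R -> V -> R) (i : 'I_n) (t : R) (x : V) : R :=
  'D_(ebasis i) (phi t) x.
Definition gradx (phi : R -> V -> R) (t : R) (x : V) : V :=
  \row_(i < n) dxi phi i t x.

Definition C1 (phi : R -> V -> R) : Prop :=
  (forall t x, derivable (fun s : R => phi s x) t 1) /\
  (forall t x i, derivable (phi t) x (ebasis i)) /\
  continuous (fun z : R * V => dt phi z.1 z.2) /\
  (forall i, continuous (fun z : R * V => dxi phi i z.1 z.2)).

Definition loc_max (f : R -> V -> R) (t : R) (x : V) : Prop :=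
  exists e : R, 0 < e /\ forall s y, `|s - t| < e -> enorm (y - x) < e ->
    f s y <= f t x.
Definition loc_min (f : R -> V -> R) (t : R) (x : V) : Prop :=
  exists e : R, 0 < e /\ forall s y, `|s - t| < e -> enorm (y - x) < e ->
    f t x <= f s y.

Definition superdiff (u : R -> V -> R) (t : R) (x : V) (a : R) (b : V) : Prop :=
  exists phi, C1 phi /\ loc_max (fun s y => u s y - phi s y) t x /\
    dt phi t x = a /\ gradx phi t x = b.
Definition subdiff (u : R -> V -> R) (t : R) (x : V) (a : R) (b : V) : Prop :=
  exists phi, C1 phi /\ loc_min (fun s y => u s y - phi s y) t x /\
    dt phi t x = a /\ gradx phi t x = b.

Definition interior_time (T : option R) (t : R) : Prop :=
  0 < t /\ (if T is Some T' then t < T' else True).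
Definition closed_time (T : option R) (t : R) : Prop :=
  0 <= t /\ (if T is Some T' then t <= T' else True).

Definition cont_on (T : option R) (u : R -> V -> R) : Prop :=
  {within [set z : R * V | closed_time T z.1],
     continuous (fun z : R * V => u z.1 z.2)}.

Definition forward_sol (H : V -> V -> R) (T : option R) (u : R -> V -> R) :=
  cont_on T u /\
  forall t x, interior_time T t ->
    (forall a b, superdiff u t x a b -> a + H x b <= 0) /\
    (forall a b, subdiff u t x a b -> 0 <= a + H x b).

Definition backward_sol (H : V -> V -> R) (T : option R) (w : R -> V -> R) :=
  cont_on T w /\
  forall t x, interior_time T t ->
    (forall a b, superdiff w t x a b -> 0 <= a + H x b) /\
    (forall a b, subdiff w t x a b -> a + H x b <= 0).

Definition bilateral_sol H T u := forward_sol H T u /\ backward_sol H T u.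

(* reconstructibility in time T (the forward/backward solutions being unique,
   "the" solutions are quantified universally) *)
Definition reconstructible (H : V -> V -> R) (g0 : V -> R) (T : R) : Prop :=
  forall u w : R -> V -> R,
    forward_sol H (Some T) u -> (forall x, u 0 x = g0 x) ->
    backward_sol H (Some T) w -> (forall x, w T x = u T x) ->
    forall x, w 0 x = g0 x.

End Defs.

(* Main.v *)
(* Convexity in p and concavity in x together with the growth bound make H
   Lipschitz in p with constant M(1+|x|) and Lipschitz in x with constant
   M(1+|p|).  Hence information travels at speed at most M(1+|x|), and a
   comparison principle by doubling of variables holds without any growth
   condition on the solutions: the barrier exp(N(e^{Ct}(1+|x|^2) - B)) confines
   the minimum.  Since H is concave in x, the three-point version of the
   comparison, between u(t, l x + (1-l) y) and l u(t,x) + (1-l) u(t,y), shows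
   that u(t, .) stays convex.

   For u convex in x, forward implies backward by local arguments.  At a
   superdifferential (a,b), b is a subgradient of u(t, .), so the supersolution
   property bounds u(s,x) - u(t,x) from below by -(s-t)(H(x,b) + o(1)).  At a
   subdifferential (a,b), take v almost in the subdifferential of H(x, .) at b:
   the subsolution property bounds the growth of u along y = x + v(s-t) by
   (s-t)(v.b - H(x,b) + o(1)).  Reconstructibility is then the comparison
   principle for -H after reversing time. *)

Require Import Defs.
From HB Require Import structures.
From mathcomp Require Import all_boot all_order all_algebra.
From mathcomp Require Import all_classical all_reals all_analysis.
From mathcomp Require Import ring lra.
Import Order.TTheory GRing.Theory Num.Theory.
Import numFieldNormedType.Exports.
Local Open Scope classical_set_scope.
Local Open Scope ring_scope.
Set Implicit Arguments. Unset Strict Implicit. Unset Printing Implicit Defensive.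

(** A backward solution satisfies the reverse of the forward inequalities, so these cannot be read
    off at the point of contact itself; at a concave kink they generally fail. Both local arguments
    therefore go by contradiction and move the contact: a failure at [(t, x)] produces a test
    function touching [u] at a slightly later time, where the forward inequality is violated. The
    penalties are sized so that this new contact avoids the boundary of a small cylinder, including
    its bottom at time [t].

    For a subdifferential, the momentum at the new contact is unknown, and the error caused by the
    x-dependence of [H] grows with it. Convexity supplies the missing Lipschitz bound: a gradient of
    contact from above is a subgradient, hence bounded by the oscillation of [u].

    In the comparison principle the same error has the size M(1+2k|Z|)|Z|, with Z the spatial
    mismatch of the doubled points. It is harmless because k|Z|^2 is dominated by a small
    oscillation of [u]. As solutions may grow arbitrarily fast, the radius of the barrier has to be
    fixed before its height, which depends on the bounds of the functions inside that radius. *)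

Section Euclid.
Variables (R : realType) (n : nat).
Local Notation V := 'rV[R]_n.
Implicit Types (x y z : V) (c : R).

(** * Euclidean inner product and norm, continuity and compact balls *)

Definition dot x y : R := \sum_(i < n) x ord0 i * y ord0 i.

Lemma dotC x y : dot x y = dot y x.
Proof. by apply: eq_bigr => i _; rewrite mulrC. Qed.

Lemma dotDl x y z : dot (x + y) z = dot x z + dot y z.
Proof. by rewrite -big_split; apply: eq_bigr => i _ /=; rewrite mxE mulrDl. Qed.

Lemma dotZl c x y : dot (c *: x) y = c * dot x y.
Proof. by rewrite mulr_sumr; apply: eq_bigr => i _; rewrite mxE mulrA. Qed.

Lemma dotNl x y : dot (- x) y = - dot x y.
Proof. by rewrite -scaleN1r dotZl mulN1r. Qed.

Lemma dotBl x y z : dot (x - y) z = dot x z - dot y z.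
Proof. by rewrite dotDl dotNl. Qed.

Lemma dotDr x y z : dot x (y + z) = dot x y + dot x z.
Proof. by rewrite !(dotC x) dotDl. Qed.

Lemma dotZr c x y : dot x (c *: y) = c * dot x y.
Proof. by rewrite !(dotC x) dotZl. Qed.

Lemma dotNr x y : dot x (- y) = - dot x y.
Proof. by rewrite !(dotC x) dotNl. Qed.

Lemma dotBr x y z : dot x (y - z) = dot x y - dot x z.
Proof. by rewrite dotDr dotNr. Qed.

Lemma dot0l x : dot 0 x = 0.
Proof. by rewrite -(scale0r 0) dotZl mul0r. Qed.

Lemma dot0r x : dot x 0 = 0.
Proof. by rewrite dotC dot0l. Qed.

Lemma dot_ge0 x : 0 <= dot x x.
Proof. by apply: sumr_ge0 => i _; rewrite -expr2 sqr_ge0. Qed.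

Lemma sqr_enorm x : enorm x ^+ 2 = dot x x.
Proof.
rewrite /enorm sqr_sqrtr; last by apply: sumr_ge0 => i _; rewrite sqr_ge0.
by apply: eq_bigr => i _; rewrite expr2.
Qed.

Lemma enorm_ge0 x : 0 <= enorm x.
Proof. exact: sqrtr_ge0. Qed.

Lemma coord_le_enorm x i : `|x ord0 i| <= enorm x.
Proof.
rewrite -(ler_pXn2r (_ : 0 < 2)%N) ?nnegrE ?enorm_ge0 //.
rewrite sqr_enorm /dot (bigD1 i) //= real_normK ?num_real // expr2 lerDl.
by apply: sumr_ge0 => j _; rewrite -expr2 sqr_ge0.
Qed.

Lemma enorm0 : enorm (0 : V) = 0.
Proof. by apply/eqP; rewrite -sqrf_eq0 sqr_enorm dot0l. Qed.

Lemma enorm_eq0 x : enorm x = 0 -> x = 0.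
Proof.
move=> x0; apply/matrixP => i j; rewrite mxE (ord1 i).
by apply/eqP; rewrite -normr_le0 -x0 coord_le_enorm.
Qed.

Lemma enormZ c x : enorm (c *: x) = `|c| * enorm x.
Proof.
apply/eqP; rewrite -(eqrXn2 (_ : 0 < 2)%N) ?mulr_ge0 ?enorm_ge0 //.
by rewrite exprMn !sqr_enorm dotZl dotZr real_normK ?num_real // expr2 mulrA.
Qed.

Lemma enormN x : enorm (- x) = enorm x.
Proof. by rewrite -scaleN1r enormZ normrN1 mul1r. Qed.

Lemma enorm_distC x y : enorm (x - y) = enorm (y - x).
Proof. by rewrite -enormN opprB. Qed.

Lemma dot_le_enorm x y : `|dot x y| <= enorm x * enorm y.
Proof.
have [->|x0] := eqVneq x 0; first by rewrite dot0l normr0 mulr_ge0 ?enorm_ge0.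
have dx : 0 < dot x x.
  rewrite lt_neqAle dot_ge0 andbT eq_sym -sqr_enorm sqrf_eq0.
  by apply: contra x0 => /eqP/enorm_eq0 ->.
rewrite -(ler_pXn2r (_ : 0 < 2)%N) ?nnegrE ?mulr_ge0 ?enorm_ge0 //.
rewrite exprMn !sqr_enorm real_normK ?num_real //.
(* Cauchy-Schwarz: the component of [y] orthogonal to [x] has a nonnegative square. *)
have := dot_ge0 (y - (dot x y / dot x x) *: x).
rewrite dotBl !dotBr !dotZl !dotZr (dotC y x) divfK ?gt_eqF // subrr subr0.
by rewrite subr_ge0 mulrAC ler_pdivrMr // -expr2 mulrC.
Qed.

Lemma enormD x y : enorm (x + y) <= enorm x + enorm y.
Proof.
rewrite -(ler_pXn2r (_ : 0 < 2)%N) ?nnegrE ?addr_ge0 ?enorm_ge0 //.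
rewrite sqrrD !sqr_enorm dotDl !dotDr (dotC y x).
have := le_trans (ler_norm _) (dot_le_enorm x y); lra.
Qed.

Lemma enorm_le_sum x y z : enorm (x - z) <= enorm (x - y) + enorm (y - z).
Proof. by apply: le_trans (enormD _ _); rewrite addrA subrK. Qed.

Lemma continuous_sum (T : topologicalType) (I : Type) (r : seq I)
    (F : I -> T -> R) :
  (forall i, continuous (F i)) -> continuous (fun w => \sum_(i <- r) F i w).
Proof.
move=> cF; elim: r => [|i r IHr] w.
  by under eq_fun do rewrite big_nil; exact: cvg_cst.
under eq_fun do rewrite big_cons.
by apply: cvgD; [exact: cF | exact: IHr].
Qed.

Lemma dot_continuous (T : topologicalType) (f g : T -> V) :
  continuous f -> continuous g -> continuous (fun w => dot (f w) (g w)).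
Proof.
move=> cf cg; apply: continuous_sum => i w.
apply: cvgM.
  exact: (continuous_comp (cf w) (@coord_continuous _ _ _ ord0 i _)).
exact: (continuous_comp (cg w) (@coord_continuous _ _ _ ord0 i _)).
Qed.

Lemma enorm_continuous (T : topologicalType) (f : T -> V) :
  continuous f -> continuous (fun w => enorm (f w)).
Proof.
move=> cf w; rewrite (_ : (fun w => _) = Num.sqrt \o (fun w => dot (f w) (f w))).
  by apply: continuous_comp; [exact: dot_continuous | exact: sqrt_continuous].
by apply/funext => w0 /=; rewrite -sqr_enorm sqrtr_sqr ger0_norm ?enorm_ge0.
Qed.

Lemma continuous_add (T : topologicalType) (f g : T -> R) :
  continuous f -> continuous g -> continuous (fun w => f w + g w).
Proof. by move=> cf cg w; apply: cvgD; [exact: cf | exact: cg]. Qed.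

Lemma continuous_mul (T : topologicalType) (f g : T -> R) :
  continuous f -> continuous g -> continuous (fun w => f w * g w).
Proof. by move=> cf cg w; apply: cvgM; [exact: cf | exact: cg]. Qed.

Lemma continuous_sub (T : topologicalType) (f g : T -> R) :
  continuous f -> continuous g -> continuous (fun w => f w - g w).
Proof. by move=> cf cg w; apply: cvgB; [exact: cf | exact: cg]. Qed.

Lemma continuous_lincomb (T : topologicalType) (f g : T -> V) (a b : R) :
  continuous f -> continuous g -> continuous (fun w => a *: f w + b *: g w).
Proof.
move=> cf cg w; apply: cvgD; apply: cvgZ; try exact: cvg_cst.
  exact: cf.
exact: cg.
Qed.

Lemma continuous_sqr_dist (T : topologicalType) (f g : T -> V) :
  continuous f -> continuous g ->
  continuous (fun w => enorm (f w - g w) ^+ 2).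
Proof.
move=> cf cg; under eq_fun do rewrite sqr_enorm.
by apply: dot_continuous => w; apply: cvgB;
  [exact: cf | exact: cg | exact: cf | exact: cg].
Qed.

Lemma closed_le_continuous (T : topologicalType) (f g : T -> R) :
  continuous f -> continuous g -> closed [set w | f w <= g w].
Proof.
move=> cf cg.
rewrite (_ : [set w | _] = (fun w => g w - f w) @^-1` [set r | 0 <= r]).
  by apply: (closed_comp _ (@closed_ge _ 0)) => w _;
    apply: cvgB; [exact: cg | exact: cf].
by apply/seteqP; split=> w /=; rewrite subr_ge0.
Qed.

Lemma compact_eball x c : compact [set y | enorm (y - x) <= c].
Proof.
apply: bounded_closed_compact.
  exists (c + `|x|); split; first exact: num_real.
  move=> M cM y /= yc; apply: le_trans (ltW cM).
  rewrite -(subrK x y); apply: le_trans (ler_normD _ _) _.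
  rewrite lerD2r; apply: le_trans yc.
  rewrite {1}/Num.norm /= mx_normrE; apply/bigmax_leP; split=> [|[i j] _ /=].
    exact: enorm_ge0.
  by rewrite (ord1 i) coord_le_enorm.
apply: closed_le_continuous; last exact: cst_continuous.
by apply: enorm_continuous => y; apply: continuousB;
  [by move=> A | exact: cst_continuous].
Qed.

End Euclid.

(** * A calculus of smooth test functions on space-time *)

Section Calculus.
Variables (R : realType) (n : nat).
Local Notation V := 'rV[R]_n.
Implicit Types (phi psi : R -> V -> R) (g : R -> V -> V).

Definition has_grad phi (d : R -> V -> R) g :=
  [/\ forall t x, is_derive t (1 : R) (fun s => phi s x) (d t x),
      forall i t x, is_derive x (ebasis R i) (phi t) (g t x ord0 i),
      continuous (fun z : R * V => phi z.1 z.2),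
      continuous (fun z : R * V => d z.1 z.2) &
      continuous (fun z : R * V => g z.1 z.2)].

Lemma has_grad_C1 phi d g : has_grad phi d g ->
  [/\ C1 phi, forall t x, dt phi t x = d t x &
      forall t x, gradx phi t x = g t x].
Proof.
move=> [dphi gphi _ cd cg].
have dtE t x : dt phi t x = d t x by have [_] := dphi t x.
have dxE i t x : dxi phi i t x = g t x ord0 i by have [_] := gphi i t x.
split=> //; last by move=> t x; apply/rowP => i; rewrite mxE dxE.
split; first by move=> t x; have [] := dphi t x.
split; first by move=> t x i; have [] := gphi i t x.
split; first by under eq_fun do rewrite dtE.
move=> i; under eq_fun do rewrite dxE.
move=> z; exact: (continuous_comp (cg z) (@coord_continuous _ _ _ ord0 i _)).
Qed.

Lemma has_grad_ext phi psi d e g k :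
  (forall t x, phi t x = psi t x) -> (forall t x, d t x = e t x) ->
  (forall t x, g t x = k t x) -> has_grad phi d g -> has_grad psi e k.
Proof.
move=> pE dE gE.
have -> : psi = phi by apply/funext => t; apply/funext => x; rewrite pE.
have -> : e = d by apply/funext => t; apply/funext => x; rewrite dE.
by have -> : k = g by apply/funext => t; apply/funext => x; rewrite gE.
Qed.

Lemma has_grad_cst c : has_grad (fun _ _ => c) (fun _ _ => 0) (fun _ _ => 0).
Proof.
split; try by move=> z; exact: cvg_cst.
  by move=> t x; exact: is_derive_cst.
by move=> i t x; rewrite mxE; exact: is_derive_cst.
Qed.

Lemma has_grad_time :
  has_grad (fun t _ => t) (fun _ _ => 1) (fun _ _ => 0).
Proof.
split; try by move=> z; exact: cvg_cst.
- by move=> t x; exact: is_derive_id.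
- by move=> i t x; rewrite mxE; exact: is_derive_cst.
- by move=> z; exact: cvg_fst.
Qed.

Lemma has_gradD phi psi d e g k :
  has_grad phi d g -> has_grad psi e k ->
  has_grad (fun t x => phi t x + psi t x) (fun t x => d t x + e t x)
    (fun t x => g t x + k t x).
Proof.
move=> [h1 h2 h3 h4 h5] [k1 k2 k3 k4 k5]; split.
- by move=> t x; apply: is_deriveD.
- by move=> i t x; rewrite mxE; apply: is_deriveD.
- by move=> z; apply: cvgD; [exact: h3 | exact: k3].
- by move=> z; apply: cvgD; [exact: h4 | exact: k4].
- by move=> z; apply: cvgD; [exact: h5 | exact: k5].
Qed.

Lemma has_gradM phi psi d e g k :
  has_grad phi d g -> has_grad psi e k ->
  has_grad (fun t x => phi t x * psi t x)
    (fun t x => phi t x * e t x + psi t x * d t x)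
    (fun t x => phi t x *: k t x + psi t x *: g t x).
Proof.
move=> [h1 h2 h3 h4 h5] [k1 k2 k3 k4 k5]; split.
- by move=> t x; apply: is_deriveM.
- by move=> i t x; rewrite !mxE; apply: is_deriveM.
- by move=> z; apply: cvgM; [exact: h3 | exact: k3].
- move=> z; apply: cvgD; apply: cvgM;
    [exact: h3 | exact: k4 | exact: k3 | exact: h4].
- move=> z; apply: cvgD; apply: cvgZ;
    [exact: h3 | exact: k5 | exact: k3 | exact: h5].
Qed.

Lemma has_gradZ c phi d g : has_grad phi d g ->
  has_grad (fun t x => c * phi t x) (fun t x => c * d t x)
    (fun t x => c *: g t x).
Proof.
move=> h; apply: has_grad_ext (has_gradM (has_grad_cst c) h) => // t x.
  by rewrite mulr0 addr0.
by rewrite scaler0 addr0.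
Qed.

Lemma has_gradB phi psi d e g k :
  has_grad phi d g -> has_grad psi e k ->
  has_grad (fun t x => phi t x - psi t x) (fun t x => d t x - e t x)
    (fun t x => g t x - k t x).
Proof.
move=> h1 h2.
by apply: has_grad_ext (has_gradD h1 (has_gradZ (-1) h2)) => t x;
  rewrite ?mulN1r ?scaleN1r.
Qed.

(** The difference quotients coincide. This brings the one-variable chain rule and mean value
    theorem to directional derivatives. *)
Lemma is_derive_line (U : normedModType R) (f : U -> R) (x v : U) s df :
  is_derive (s *: v + x) v f df <->
  is_derive s 1 (fun h : R => f (h *: v + x)) df.
Proof.
have E : (fun h : R => h^-1 *: ((f \o shift (s *: v + x)) (h *: v)
      - f (s *: v + x))) =
    (fun h : R => h^-1 *: (((fun h : R => f (h *: v + x)) \o shift s) (h *: 1)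
      - f (s *: v + x))).
  apply/funext => h /=; congr (_ *: (f _ - _)).
  by rewrite -[h *: 1]/(h * 1) mulr1 scalerDl addrA.
split=> -[d1 d2]; split; first by rewrite /derivable -E.
- by rewrite /derive -E.
- by rewrite /derivable E.
- by rewrite /derive E.
Qed.

Lemma is_derive_expR_comp (U : normedModType R) (f : U -> R) (x v : U) df :
  is_derive x v f df -> is_derive x v (fun y => expR (f y)) (expR (f x) * df).
Proof.
move=> h.
have x0 : (0 : R) *: v + x = x by rewrite scale0r add0r.
have {}h : is_derive (0 : R) 1 (fun s : R => f (s *: v + x)) df.
  by have := (is_derive_line f x v 0 df).1; rewrite x0; apply.
have := (is_derive_line (fun y => expR (f y)) x v 0 (expR (f x) * df)).2.
rewrite x0; apply.
have [d1 d2] := h.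
have D : derivable (expR : R -> R) (f ((0 : R) *: v + x)) 1.
  exact: derivable_expR.
have DC : derivable (fun s : R => expR (f (s *: v + x))) 0 1.
  apply/derivable1_diffP; apply: differentiable_comp; exact/derivable1_diffP.
split=> //.
rewrite -derive1E (derive1_comp d1 D) !derive1E d2.
by have [_ ->] := is_derive_expR (f ((0 : R) *: v + x)); rewrite x0.
Qed.

Lemma has_grad_expR phi d g : has_grad phi d g ->
  has_grad (fun t x => expR (phi t x)) (fun t x => expR (phi t x) * d t x)
    (fun t x => expR (phi t x) *: g t x).
Proof.
move=> [h1 h2 h3 h4 h5].
have cE : continuous (fun z : R * V => expR (phi z.1 z.2)).
  by move=> z; apply: (continuous_comp (h3 z) (@continuous_expR R _)).
split=> //.
- by move=> t x; apply: is_derive_expR_comp.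
- by move=> i t x; rewrite mxE; apply: is_derive_expR_comp.
- by move=> z; apply: cvgM; [exact: cE | exact: h4].
- by move=> z; apply: cvgZ; [exact: cE | exact: h5].
Qed.

Lemma is_derive_coord i (x v : V) :
  is_derive x v (fun y : V => y ord0 i) (v ord0 i).
Proof.
have E : (fun h : R => h^-1 *: (((fun y : V => y ord0 i) \o shift x) (h *: v)
    - x ord0 i)) @ 0^' --> v ord0 i.
  apply: cvg_near_cst; near=> h.
  rewrite /= !mxE addrK scalerA mulVf ?scale1r //.
  by near: h; exact: nbhs_dnbhs_neq.
by split; [apply/cvg_ex; exists (v ord0 i) | apply: cvg_lim E].
Unshelve. all: by end_near. Qed.

Lemma is_derive_fsum (I : Type) (r : seq I) (F : I -> V -> R) (x v : V)
    (dF : I -> R) :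
  (forall i, is_derive x v (F i) (dF i)) ->
  is_derive x v (fun y => \sum_(i <- r) F i y) (\sum_(i <- r) dF i).
Proof.
move=> h; elim: r => [|i r IHr].
  under eq_fun do rewrite big_nil; rewrite big_nil; exact: is_derive_cst.
under eq_fun do rewrite big_cons; rewrite big_cons; exact: is_deriveD.
Qed.

Lemma sum_ebasis (F : 'I_n -> R) i :
  \sum_(j < n) F j * ebasis R i ord0 j = F i.
Proof.
rewrite (bigD1 i) //= mxE !eqxx mulr1 big1 ?addr0 // => j ji.
by rewrite mxE eqxx (negbTE ji) mulr0.
Qed.

Lemma has_grad_lin (b : V) :
  has_grad (fun _ x => dot b x) (fun _ _ => 0) (fun _ _ => b).
Proof.
split; try by move=> z; exact: cvg_cst.
- by move=> t x; exact: is_derive_cst.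
- move=> i t x; rewrite -(sum_ebasis (b ord0) i); apply: is_derive_fsum => j.
  have := is_deriveZ (b ord0 j) (is_derive_coord j x (ebasis R i)).
  exact.
- by apply: dot_continuous => z; [exact: cvg_cst | exact: cvg_snd].
Qed.

Lemma has_grad_sqr :
  has_grad (fun _ x => dot x x) (fun _ _ => 0) (fun _ x => 2 *: x).
Proof.
split; try by move=> z; exact: cvg_cst.
- by move=> t x; exact: is_derive_cst.
- move=> i t x; rewrite -(sum_ebasis ((2 *: x) ord0) i).
  apply: is_derive_fsum => j.
  have := is_deriveM (is_derive_coord j x (ebasis R i))
    (is_derive_coord j x (ebasis R i)).
  move=> /is_derive_eq; apply.
  by rewrite !mxE -[_ *: _]/(_ * _); ring.
- by apply: dot_continuous => z; exact: cvg_snd.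
- by move=> z; apply: cvgZ; [exact: cvg_cst | exact: cvg_snd].
Qed.

Lemma has_grad_sqr_affine (l : R) (a : V) :
  has_grad (fun _ x => enorm (l *: x + a) ^+ 2) (fun _ _ => 0)
    (fun _ x => (2 * l) *: (l *: x + a)).
Proof.
apply: has_grad_ext (has_gradD (has_gradD (has_gradZ (l ^+ 2) has_grad_sqr)
  (has_gradZ (2 * l) (has_grad_lin a))) (has_grad_cst (dot a a))) => t x.
- by rewrite sqr_enorm dotDl !dotDr !dotZl !dotZr (dotC x a); ring.
- by ring.
- by rewrite addr0 scalerDr !scalerA; congr (_ *: _ + _); ring.
Qed.

Lemma has_grad_sqr_time (a : R) :
  has_grad (fun t _ => (t - a) ^+ 2) (fun t _ => 2 * (t - a)) (fun _ _ => 0).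
Proof.
have h := has_gradB has_grad_time (has_grad_cst a).
apply: has_grad_ext (has_gradM h h) => t x.
- by rewrite expr2.
- by ring.
- by rewrite subr0 scaler0 addr0.
Qed.

Lemma has_grad_sqr_moving (t : R) (w v : V) :
  has_grad (fun s y => enorm (y - (w + (s - t) *: v)) ^+ 2)
    (fun s y => - 2 * dot v (y - (w + (s - t) *: v)))
    (fun s y => 2 *: (y - (w + (s - t) *: v))).
Proof.
have ht := has_gradB has_grad_time (has_grad_cst t).
have hl := has_gradB (has_grad_lin v) (has_grad_cst (dot v w)).
apply: has_grad_ext (has_gradD (has_gradB (has_grad_sqr_affine 1 (- w))
  (has_gradZ 2 (has_gradM ht hl))) (has_gradZ (dot v v) (has_grad_sqr_time t)))
  => s y.
- rewrite !sqr_enorm scale1r !dotBl !dotBr !dotDl !dotDr !dotZl !dotZr.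
  by rewrite (dotC w y) (dotC v y) (dotC v w); ring.
- by rewrite dotBr dotDr dotZr; ring.
- by apply/rowP => i; rewrite !mxE; ring.
Qed.

End Calculus.

(** * First-order expansions and uniform estimates on compact sets *)

Section Taylor.
Variables (R : realType) (n : nat).
Local Notation V := 'rV[R]_n.

(** Neighbourhoods of row vectors are those of the largest coordinate, which the Euclidean norm
    dominates. *)
Lemma near_enorm (P : R * V -> Prop) (t : R) (x : V) : (\forall z \near (t, x), P z) ->
  exists2 r : R, 0 < r & forall s y, `|s - t| < r -> enorm (y - x) < r -> P (s, y).
Proof.
move=> /nbhs_ballP[e /= e0 eP]; exists e => // s y st yx; apply: eP; split => /=.
  by rewrite -ball_normE /= distrC.
split=> // i j; rewrite (ord1 i) -ball_normE /= distrC.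
by apply: le_lt_trans yx; have := coord_le_enorm (y - x) j; rewrite !mxE.
Qed.

Lemma continuous_enorm (f : R * V -> R) (t : R) (x : V) (e : R) :
  continuous f -> 0 < e -> exists2 r : R, 0 < r &
    forall s y, `|s - t| < r -> enorm (y - x) < r -> `|f (s, y) - f (t, x)| < e.
Proof.
move=> cf e0; apply: (@near_enorm (fun z => `|f z - f (t, x)| < e)).
have /cvgrPdist_lt/(_ e e0) := cf (t, x).
by apply: filterS => z; rewrite distrC.
Qed.

Lemma MVT_line (U : normedModType R) (f : U -> R) (v x : U) (c : R) :
  (forall y, derivable f y v) -> exists2 k : R, `|k| <= `|c| &
    f (c *: v + x) - f x = c * 'D_v f (k *: v + x).
Proof.
move=> df; pose h (s : R) := f (s *: v + x).
have dh (s : R) : is_derive s 1 h ('D_v f (s *: v + x)).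
  exact: (is_derive_line f x v s _).1 (derivableP (df _)).
have ch (a b : R) : {within `[a, b], continuous h}.
  apply: continuous_subspaceT => s; apply: differentiable_continuous.
  by apply/derivable1_diffP; have [] := dh s.
have h0 : h 0 = f x by rewrite /h scale0r add0r.
have [c0|/ltW c0] := leP 0 c.
  have [k] := MVT_segment c0 (fun s _ => dh s) (ch _ _).
  rewrite in_itv /= => /andP[k0 kc]; rewrite h0 subr0 mulrC => E.
  by exists k => //; rewrite !ger0_norm.
have [k] := MVT_segment c0 (fun s _ => dh s) (ch _ _).
rewrite in_itv /= => /andP[ck k0]; rewrite h0 sub0r => E.
exists k; first by rewrite !ler0_norm // lerN2.
by rewrite -opprB E mulrN opprK mulrC.
Qed.

Lemma enorm_mono (x y : V) : (forall i, `|x ord0 i| <= `|y ord0 i|) ->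
  enorm x <= enorm y.
Proof.
move=> xy; rewrite /enorm ler_wsqrtr //; apply: ler_sum => i _.
by rewrite -(real_normK (num_real (x _ _))) -(real_normK (num_real (y _ _)))
  ler_pXn2r ?nnegrE.
Qed.

(** Only partial derivatives are given, so the path from [x] to [y] changes one coordinate at a
    time, with the mean value theorem on each leg. Every point of the path differs from [x] by no
    more than [y] does in each coordinate, hence stays in the ball where the partial derivatives are
    controlled. *)
Lemma C1_space_increment (phi : R -> V -> R) (g x y : V) (s e : R) :
  (forall i z, derivable (phi s) z (ebasis R i)) ->
  (forall i z, enorm (z - x) <= enorm (y - x) ->
    `|dxi phi i s z - g ord0 i| <= e) ->
  `|phi s y - phi s x - dot g (y - x)| <= n%:R * e * enorm (y - x).
Proof.
move=> dphi he.
pose z k : V := \row_(i < n) if (i < k)%N then y ord0 i else x ord0 i.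
have z0 : z 0%N = x by apply/rowP => i; rewrite mxE.
have zn : z n = y by apply/rowP => i; rewrite mxE ltn_ord.
have zS (k : 'I_n) : z k.+1 = (y ord0 k - x ord0 k) *: ebasis R k + z k.
  apply/rowP => i; rewrite !mxE eqxx /= ltnS.
  have [->|ik] := eqVneq i k; first by rewrite leqnn ltnn mulr1 subrK.
  by rewrite mulr0 add0r leq_eqVlt (negbTE (_ : (i : nat) != k)).
have -> : phi s y - phi s x = \sum_(k < n) (phi s (z k.+1) - phi s (z k)).
  by rewrite -(big_mkord xpredT (fun k => phi s (z k.+1) - phi s (z k)))
    telescope_sumr // z0 zn.
rewrite /dot -sumrB; apply: le_trans (ler_norm_sum _ _ _) _.
apply: (@le_trans _ _ (\sum_(k < n) e * enorm (y - x))); last first.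
  by rewrite sumr_const card_ord -mulrA -[_ *+ n]mulr_natl.
apply: ler_sum => k _.
have [c ck E] := MVT_line (z k) (y ord0 k - x ord0 k) (dphi k).
rewrite zS E [g _ _ * _]mulrC !mxE -mulrBr normrM mulrC.
have e0 : 0 <= e by apply: le_trans (he k x _); rewrite ?subrr ?enorm0 ?enorm_ge0.
apply: ler_pM => //; last by have := coord_le_enorm (y - x) k; rewrite !mxE.
apply: he; apply: enorm_mono => i; rewrite !mxE eqxx /=.
have [->|ik] := eqVneq i k; first by rewrite ltnn mulr1 addrK.
rewrite mulr0 add0r; case: ifP => // _.
by rewrite subrr normr0 normr_ge0.
Qed.

Lemma C1_expansion (phi : R -> V -> R) (t : R) (x : V) (e : R) :
  C1 phi -> 0 < e -> exists2 r : R, 0 < r &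
    forall s y, `|s - t| < r -> enorm (y - x) < r ->
    `|phi s y - phi t x - (s - t) * dt phi t x - dot (gradx phi t x) (y - x)|
      <= e * (`|s - t| + enorm (y - x)).
Proof.
move=> [dphi [gphi [cd cg]]] e0.
(* Dividing by [n + 1] gives both [n * e' <= e] for the spatial legs and [e' <= e] for the time leg,
   in dimension 0 as well. *)
pose e' := e / n.+1%:R.
have e'0 : 0 < e' by rewrite divr_gt0.
have e'e : n%:R * e' <= e /\ e' <= e.
  have E : e' * n.+1%:R = e by rewrite divfK.
  split; rewrite -[leRHS]E; last first.
    by apply: ler_peMr; [exact: ltW | rewrite ler1n].
  by rewrite [leRHS]mulrC ler_pM2r // ler_nat.
have [r1 r10 h1] := continuous_enorm t x cd e'0.
have [r2 r20 h2] : exists2 r : R, 0 < r & forall s y, `|s - t| < r ->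
    enorm (y - x) < r ->
    forall i, `|dxi phi i s y - dxi phi i t x| < e'.
  apply: (@near_enorm (fun z => forall i, `|dxi phi i z.1 z.2 - dxi phi i t x| < e')).
  apply: (@filter_forall _ _ (fun i (z : R * V) =>
    `|dxi phi i z.1 z.2 - dxi phi i t x| < e') _ (nbhs_filter _)) => i.
  have /cvgrPdist_lt/(_ e' e'0) := cg i (t, x).
  by apply: filterS => z; rewrite distrC.
exists (Num.min r1 r2); first by rewrite lt_min r10.
move=> s y; rewrite !lt_min => /andP[s1 s2] /andP[y1 y2].
have A : `|phi s y - phi s x - dot (gradx phi t x) (y - x)|
    <= n%:R * e' * enorm (y - x).
  apply: C1_space_increment => [i z|i z zx]; first exact: gphi.
  by rewrite mxE ltW // h2 // (le_lt_trans zx).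
have B : `|phi s x - phi t x - (s - t) * dt phi t x| <= e' * `|s - t|.
  have [k kst E] := MVT_line t (s - t) (fun s => dphi s x).
  move: E; rewrite -[(s - t) *: 1]/((s - t) * 1) mulr1 subrK => ->.
  rewrite -mulrBr normrM mulrC ler_wpM2r //.
  rewrite -[k *: 1]/(k * 1) mulr1 ltW // (h1 (k + t) x) ?addrK ?subrr ?enorm0 //.
  exact: le_lt_trans s1.
have -> : phi s y - phi t x - (s - t) * dt phi t x - dot (gradx phi t x) (y - x) =
    (phi s y - phi s x - dot (gradx phi t x) (y - x)) +
    (phi s x - phi t x - (s - t) * dt phi t x) by ring.
apply: le_trans (ler_normD _ _) _; rewrite mulrDr addrC lerD //.
  by apply: le_trans B _; rewrite ler_wpM2r // e'e.2.
by apply: le_trans A _; rewrite ler_wpM2r ?enorm_ge0 // e'e.1.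
Qed.

(** The pairs of points of [K] whose values differ by at least [e] form a compact set off the
    diagonal; their distance attains a positive minimum, half of which serves as modulus. *)
Lemma compact_unif_continuous (f : R * V -> R) (K : set (R * V)) (e : R) :
  continuous f -> compact K -> 0 < e -> exists2 r : R, 0 < r &
    forall s y t x, K (s, y) -> K (t, x) -> `|s - t| < r -> enorm (y - x) < r ->
    `|f (s, y) - f (t, x)| < e.
Proof.
move=> cf cK e0.
pose D (w : (R * V) * (R * V)) := `|w.1.1 - w.2.1| + enorm (w.1.2 - w.2.2).
pose A := (K `*` K) `&` [set w : (R * V) * (R * V) | e <= `|f w.1 - f w.2|].
have c1 (T1 T2 : topologicalType) : continuous (@fst T1 T2).
  by move=> w; exact: cvg_fst.
have c2 (T1 T2 : topologicalType) : continuous (@snd T1 T2).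
  by move=> w; exact: cvg_snd.
have ce : continuous (fun w : (R * V) * (R * V) => enorm (w.1.2 - w.2.2)).
  apply: (@enorm_continuous R n ((R * V) * (R * V))%type) => w.
  apply: cvgB.
    exact: (continuous_comp (c1 _ _ w) (c2 _ _ w.1)).
  exact: (continuous_comp (c2 _ _ w) (c2 _ _ w.2)).
have cD : continuous D.
  move=> w; apply: cvgD.
    apply: cvg_norm; apply: cvgB.
      exact: (continuous_comp (c1 _ _ w) (c1 _ _ w.1)).
    exact: (continuous_comp (c2 _ _ w) (c1 _ _ w.2)).
  exact: ce.
have cA : compact A.
  apply: compact_closedI; first exact: compact_setX.
  apply: closed_le_continuous => w; first exact: cvg_cst.
  apply: cvg_norm; apply: cvgB.
    exact: (continuous_comp (c1 _ _ w) (cf w.1)).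
  exact: (continuous_comp (c2 _ _ w) (cf w.2)).
have [A0|A0] := pselect (A !=set0); last first.
  exists 1 => // s y t x Ks Kt _ _; rewrite ltNge; apply/negP => fe.
  by apply: A0; exists ((s, y), (t, x)).
have [w0] := compact_EVT_min A0 cA (continuous_subspaceT cD).
rewrite inE => -[[K1 K2] w0e] Dmin.
have D0 : 0 < D w0.
  rewrite lt_neqAle addr_ge0 ?enorm_ge0 // andbT eq_sym.
  apply/eqP => /eqP; rewrite paddr_eq0 ?enorm_ge0 // => /andP[/eqP/normr0_eq0].
  move=> /eqP; rewrite subr_eq0 => /eqP E1 /eqP/enorm_eq0/eqP.
  rewrite subr_eq0 => /eqP E2; move: w0e => /=.
  by rewrite (surjective_pairing w0.1) E1 E2 -surjective_pairing subrr normr0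
    leNgt e0.
exists (D w0 / 2); first by rewrite divr_gt0.
move=> s y t x Ks Kt st yx; rewrite ltNge; apply/negP => fe.
have : D w0 <= D ((s, y), (t, x)) by apply: Dmin; rewrite inE.
by rewrite leNgt /D /= [X in _ < X]splitr ltrD.
Qed.

Lemma compact_EVT_bound (f : R * V -> R) (K : set (R * V)) :
  continuous f -> compact K ->
  exists2 B : R, 0 <= B & forall t x, K (t, x) -> `|f (t, x)| <= B.
Proof.
move=> cf cK; have [K0|K0] := pselect (K !=set0); last first.
  by exists 0 => // t x Kx; case: K0; exists (t, x).
have cn : continuous (fun z => `|f z|) by move=> z; apply: cvg_norm; exact: cf.
have [w _ wmax] := compact_EVT_max K0 cK (continuous_subspaceT cn).
by exists `|f w| => // t x Kx; apply: wmax; rewrite inE.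
Qed.

End Taylor.

(** * Convex functions: Lipschitz bounds from growth, approximate subgradients *)

Section Convex.
Variables (R : realType) (n : nat).
Local Notation V := 'rV[R]_n.

(** Replaces the passage to the limit as [l] tends to 0, here and in the first-order conditions
    below. *)
Lemma ge0_of_linear (X Y l0 : R) : 0 < l0 ->
  (forall l, 0 < l -> l <= l0 -> 0 <= X + l * Y) -> 0 <= X.
Proof.
move=> l00 h; rewrite leNgt; apply/negP => X0.
pose l := Num.min l0 (- X / (2 * (`|Y| + 1))).
have Y1 : 0 < 2 * (`|Y| + 1) by rewrite mulr_gt0 // ltr_wpDl.
have l0' : 0 < l by rewrite lt_min l00 divr_gt0 // oppr_gt0.
have := h l l0'; rewrite ge_min lexx => /(_ isT).
have : l * Y <= - X / 2.
  apply: (@le_trans _ _ (l * (`|Y| + 1))).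
    by rewrite ler_pM2l // (le_trans (ler_norm Y)) // lerDl.
  rewrite -ler_pdivlMr ?ltr_wpDl // -mulrA -invfM.
  by rewrite /l ge_min lexx orbT.
lra.
Qed.

(** The point [q] lies between [p] and the distant point [p + l^-1 *: (q - p)]. By convexity the
    slope from [p] to [q] is at most the slope to the distant point, and as [l] tends to 0 linear
    growth bounds the latter by [A]. *)
Lemma convex_growth_lipschitz (f : V -> R) (A : R) :
  convex_fun f -> 0 <= A -> (forall p, `|f p| <= A * (1 + enorm p)) ->
  forall p q, f q - f p <= A * enorm (q - p).
Proof.
move=> cf A0 fA p q; rewrite -subr_ge0.
apply: (@ge0_of_linear _ (A * (1 + enorm p) - f p) 1) => // l l0 l1.
have := cf (p + l^-1 *: (q - p)) p l (ltW l0) l1.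
have -> : l *: (p + l^-1 *: (q - p)) + (1 - l) *: p = q.
  by apply/rowP => i; rewrite !mxE; field; rewrite gt_eqF.
have := le_trans (ler_norm _) (fA (p + l^-1 *: (q - p))).
have := enormD p (l^-1 *: (q - p)).
rewrite enormZ gtr0_norm ?invr_gt0 // => h1 h2 h3.
have h4 : l * f (p + l^-1 *: (q - p)) <= A * (l + l * enorm p + enorm (q - p)).
  have -> : A * (l + l * enorm p + enorm (q - p)) =
      l * (A * (1 + (enorm p + l^-1 * enorm (q - p)))).
    by field; rewrite gt_eqF.
  by rewrite ler_pM2l // (le_trans h2) // ler_wpM2l // lerD2l.
move: h3 h4; lra.
Qed.

Lemma concave_growth_lipschitz (f : V -> R) (A : R) :
  concave_fun f -> 0 <= A -> (forall p, `|f p| <= A * (1 + enorm p)) ->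
  forall p q, f q - f p <= A * enorm (q - p).
Proof.
move=> cf A0 fA p q.
have := @convex_growth_lipschitz (fun x => - f x) A _ A0 _ q p.
rewrite opprK addrC enorm_distC; apply => [x y l l0 l1|x]; last by rewrite normrN.
by rewrite !mulrN -opprD lerN2; exact: cf.
Qed.

Lemma lipschitz_continuous (f : V -> R) (A : R) :
  (forall p q, f q - f p <= A * enorm (q - p)) -> continuous f.
Proof.
move=> fA p; apply/(@cvgrPdist_lt _ _ _ _ (nbhs_filter p)) => e e0.
have c : continuous (fun q : V => A * enorm (q - (p : V))).
  apply: (@continuous_mul R V) => [|w]; first exact: cst_continuous.
  apply: (@enorm_continuous R n V) => z.
  by apply: continuousB; [move=> B | exact: cst_continuous].
have /(@cvgrPdist_lt _ _ _ _ (nbhs_filter p))/(_ e e0) := c p.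
apply: (@filterS _ _ (nbhs_filter p)) => q /=; rewrite subrr enorm0 mulr0 sub0r normrN.
move=> /(le_lt_trans (ler_norm _)); apply: le_lt_trans.
by rewrite ler_norml lerNl opprB fA /= enorm_distC fA.
Qed.

(** A proximal step: at a minimiser [ps] of [G p + K * enorm (p - b) ^+ 2], the vector
    [- (2 * K) *: (ps - b)] is an exact subgradient of [G]. Basing the affine bound at [b] instead
    of [ps] costs at most [A * r <= e]. Compactness alone gives existence. *)
Lemma approx_subgradient (G : V -> R) (A e : R) (b : V) :
  convex_fun G -> 0 <= A -> (forall p q, G q - G p <= A * enorm (q - p)) ->
  0 < e -> exists v, forall p, G b - e + dot v (p - b) <= G p.
Proof.
move=> cG A0 GA e0.
have A1 : 0 < A + 1 by rewrite ltr_wpDl.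
pose r := e / (A + 1); have r0 : 0 < r by rewrite divr_gt0.
(* With [K * r = A + 1 > A], the penalty on the sphere of radius [r] exceeds any gain of [G], so the
   minimiser is interior. *)
pose K := (A + 1) / r; have K0 : 0 < K by rewrite divr_gt0.
pose F p := G p + K * enorm (p - b) ^+ 2.
have cF : continuous F.
  apply: (@continuous_add R V); first exact: lipschitz_continuous GA.
  apply: (@continuous_mul R V); first exact: cst_continuous.
  by apply: (@continuous_sqr_dist R n V) => [w A'|]; [|exact: cst_continuous].
have [] := compact_EVT_min _ (@compact_eball R n b r) (continuous_subspaceT cF).
  by exists b => /=; rewrite subrr enorm0 ltW.
move=> ps; rewrite inE /= => psr Fmin.
have Fb : F ps <= G b.
  have := Fmin b; rewrite inE /= subrr enorm0 ltW // => /(_ isT).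
  by rewrite {2}/F subrr enorm0 expr0n mulr0 addr0.
have KrE : K * r = A + 1 by rewrite /K divfK ?gt_eqF.
have AreE : (A + 1) * r = e by rewrite mulrC /r divfK ?gt_eqF.
have psr' : enorm (ps - b) < r.
  rewrite lt_neqAle psr andbT; apply/eqP => E.
  move: Fb (GA ps b); rewrite /F (enorm_distC b) E expr2 mulrA KrE.
  nra.
exists (- (2 * K) *: (ps - b)) => p.
(* First-order condition along the segment from [ps] to [p]; convexity of [G] makes it hold for all
   [p], not only near [ps]. *)
have key : 0 <= G p - G ps + 2 * K * dot (ps - b) (p - ps).
  pose l0 := Num.min 1 ((r - enorm (ps - b)) / (enorm (p - ps) + 1)).
  have D1 : 0 < enorm (p - ps) + 1 by rewrite ltr_wpDl ?enorm_ge0.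
  apply: (@ge0_of_linear _ (K * enorm (p - ps) ^+ 2) l0).
    by rewrite lt_min ltr01 divr_gt0 // subr_gt0.
  move=> l lp; rewrite le_min => /andP[l1 ll].
  have lin : l * enorm (p - ps) <= r - enorm (ps - b).
    rewrite ler_pdivlMr // in ll; apply: le_trans ll.
    by rewrite ler_pM2l // lerDl.
  have E : l *: p + (1 - l) *: ps - b = (ps - b) + l *: (p - ps).
    by apply/rowP => i; rewrite !mxE; ring.
  have := Fmin (l *: p + (1 - l) *: ps); rewrite inE /= E.
  have -> : enorm (ps - b + l *: (p - ps)) <= r.
    by apply: le_trans (enormD _ _) _; rewrite enormZ gtr0_norm //; lra.
  move=> /(_ isT); rewrite /F E; set a := ps - b; set d := p - ps.
  rewrite !sqr_enorm (dotDl a) !(dotDr _ a) !dotZl !dotZr (dotC d a) => h.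
  have := cG p ps l (ltW lp) l1 => h'.
  rewrite -(pmulr_rge0 _ lp).
  move: h h'; set X := dot _ _; set Y := dot _ _; set Z := dot _ _; lra.
move: key (GA ps b); rewrite dotZl.
have -> : p - ps = (p - b) - (ps - b) by rewrite opprB addrA subrK.
rewrite dotBr -sqr_enorm (enorm_distC b).
have := sqr_ge0 (enorm (ps - b)); set D := enorm _; set X := dot _ _.
have : A * D <= e.
  apply: (@le_trans _ _ (A * r)); first by rewrite ler_wpM2l.
  by rewrite -AreE ler_pM2r // lerDl.
move=> h1 h2 h3 h4.
have : 0 <= K * D ^+ 2 by rewrite mulr_ge0 // ltW.
lra.
Qed.

End Convex.

(** * Semidifferentials and one-sided solutions *)

Section Viscosity.
Variables (R : realType) (n : nat).
Local Notation V := 'rV[R]_n.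
Implicit Types (H : V -> V -> R) (u : R -> V -> R).

Definition subsol H (T : R) u := forall t x a b, 0 < t < T ->
  superdiff u t x a b -> a + H x b <= 0.

Definition supersol H (T : R) u := forall t x a b, 0 < t < T ->
  subdiff u t x a b -> 0 <= a + H x b.

Lemma supersol_test H T u phi d g t x : supersol H T u -> has_grad phi d g ->
  0 < t < T -> loc_min (fun s y => u s y - phi s y) t x ->
  0 <= d t x + H x (g t x).
Proof.
move=> su hg tT hmin; have [c1 dE gE] := has_grad_C1 hg.
by apply: (su t) => //; exists phi; rewrite dE gE.
Qed.

Lemma has_grad_superdiff u phi d g t x : has_grad phi d g ->
  loc_max (fun s y => u s y - phi s y) t x -> superdiff u t x (d t x) (g t x).
Proof.
move=> hg hmax; have [c1 dE gE] := has_grad_C1 hg.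
by exists phi; rewrite dE gE.
Qed.

Lemma superdiff_local u w t x a b (r : R) : 0 < r ->
  (forall s y, `|s - t| < r -> u s y = w s y) ->
  superdiff u t x a b -> superdiff w t x a b.
Proof.
move=> r0 uw [phi [c1 [[e [e0 he]] h]]]; exists phi; split=> //; split=> //.
exists (Num.min e r); split; first by rewrite lt_min e0.
move=> s y; rewrite !lt_min => /andP[se sr] /andP[ye _].
by rewrite -!uw ?subrr ?normr0 //; exact: he.
Qed.

Lemma subdiff_local u w t x a b (r : R) : 0 < r ->
  (forall s y, `|s - t| < r -> u s y = w s y) ->
  subdiff u t x a b -> subdiff w t x a b.
Proof.
move=> r0 uw [phi [c1 [[e [e0 he]] h]]]; exists phi; split=> //; split=> //.
exists (Num.min e r); split; first by rewrite lt_min e0.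
move=> s y; rewrite !lt_min => /andP[se sr] /andP[ye _].
by rewrite -!uw ?subrr ?normr0 //; exact: he.
Qed.

Lemma superdiff_expansion u t x a b (e : R) : superdiff u t x a b -> 0 < e ->
  exists2 r : R, 0 < r & forall s y, `|s - t| < r -> enorm (y - x) < r ->
    u s y <= u t x + (s - t) * a + dot b (y - x) + e * (`|s - t| + enorm (y - x)).
Proof.
move=> [phi [c1 [[r1 [r10 h1]] [<- <-]]]] e0.
have [r2 r20 h2] := C1_expansion t x c1 e0.
exists (Num.min r1 r2); first by rewrite lt_min r10.
move=> s y; rewrite !lt_min => /andP[s1 s2] /andP[y1 y2].
have := h1 s y s1 y1; have := le_trans (ler_norm _) (h2 s y s2 y2); lra.
Qed.

Lemma subdiff_expansion u t x a b (e : R) : subdiff u t x a b -> 0 < e ->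
  exists2 r : R, 0 < r & forall s y, `|s - t| < r -> enorm (y - x) < r ->
    u t x + (s - t) * a + dot b (y - x) - e * (`|s - t| + enorm (y - x)) <= u s y.
Proof.
move=> [phi [c1 [[r1 [r10 h1]] [<- <-]]]] e0.
have [r2 r20 h2] := C1_expansion t x c1 e0.
exists (Num.min r1 r2); first by rewrite lt_min r10.
move=> s y; rewrite !lt_min => /andP[s1 s2] /andP[y1 y2].
have := h2 s y s2 y2; rewrite ler_norml => /andP[].
have := h1 s y s1 y1; lra.
Qed.

(** The superdifferential bounds [u t] from above at a point just beyond [x], opposite to [y]. As
    [x] lies between that point and [y], convexity turns this into a lower bound at [y]. *)
Lemma superdiff_convex_subgradient u t x a b y : convex_fun (u t) ->
  superdiff u t x a b -> u t x + dot b (y - x) <= u t y.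
Proof.
move=> cu hs; pose D := enorm (y - x).
rewrite -subr_ge0; apply: (@ge0_of_linear R _ D 1) => // e e0 _.
have [r r0 h] := superdiff_expansion hs e0.
have D0 : 0 <= D := enorm_ge0 _.
(* This choice gives [l * D < r], and remains positive when [y = x]. *)
pose l := r / (D + r); have Dr : 0 < D + r by rewrite ltr_wpDl.
have l0 : 0 < l by rewrite divr_gt0.
have lD : l * D < r.
  by rewrite /l mulrAC ltr_pdivrMr // ltr_pM2l // ltrDl.
have E : x - l *: (y - x) - x = - (l *: (y - x)) by rewrite addrAC subrr sub0r.
have := h t (x - l *: (y - x)); rewrite E enormN enormZ.
rewrite subrr normr0 gtr0_norm // => /(_ r0 lD).
rewrite dotNr dotZr mul0r add0r addr0 -/D => h1.
have l1 : 0 < 1 + l by rewrite addr_gt0.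
have := cu (x - l *: (y - x)) y (1 + l)^-1.
rewrite invr_ge0 (ltW l1) invf_le1 // lerDl (ltW l0) => /(_ isT isT).
have -> : (1 + l)^-1 *: (x - l *: (y - x)) + (1 - (1 + l)^-1) *: y = x.
  by apply/rowP => i; rewrite !mxE; field; rewrite gt_eqF.
set z := x - _ in h1 *; move=> h2.
have h3 : (1 + l) * u t x <= u t z + l * u t y.
  have -> : u t z + l * u t y =
    (1 + l) * ((1 + l)^-1 * u t z + (1 - (1 + l)^-1) * u t y).
    by field; rewrite gt_eqF.
  by rewrite ler_pM2l.
rewrite -(pmulr_rge0 _ l0); move: h1 h3; lra.
Qed.

End Viscosity.

(** * The barrier and the inequality at a minimum of the doubled function *)

Section Comparison.
Variables (R : realType) (n : nat).
Local Notation V := 'rV[R]_n.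

(** [P] is large once e^{Ct}(1+|x|^2) reaches [B] and tiny well below that level. The last clause
    makes its growth in time dominate transport at the maximal speed M(1+|x|). The radius [r0] does
    not depend on [kappa], so [kappa] can be chosen from bounds on the cylinder that [r0]
    determines. *)
Lemma exists_barrier (M t0 T' X0 : R) : 0 <= M -> 0 <= t0 -> t0 < T' -> 0 <= X0 ->
  exists2 r0 : R, X0 <= r0 & forall kappa eta : R, 0 < kappa -> 0 < eta ->
  exists P d c : R -> V -> R,
  [/\ has_grad P d (fun t x => c t x *: x), forall t x, 0 <= P t x,
    forall t x, 0 <= t -> T' <= t \/ r0 <= enorm x -> kappa <= P t x,
    forall x, enorm x <= X0 -> P t0 x <= eta &
    forall t x, M * (1 + enorm x) * (`|c t x| * enorm x) <= d t x].
Proof.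
move=> M0 t00 t0T X00.
have dT : 0 < T' - t0 by rewrite subr_gt0.
(* [4 * M] absorbs the transport term, as 2r(1+r) <= 4(1+r^2). The second summand makes e^{C(T'-t0)}
   at least 3+X0^2, so that the level at [t0] within [X0] is at most [B - 1]. *)
pose C := 4 * M + (2 + X0 ^+ 2) / (T' - t0).
have C1 : 0 <= (2 + X0 ^+ 2) / (T' - t0).
  by rewrite divr_ge0 ?(ltW dT) // addr_ge0 ?sqr_ge0.
have C4 : 4 * M <= C by rewrite lerDl.
have C0 : 0 <= C by rewrite addr_ge0 // mulr_ge0.
pose B := expR (C * T').
have B0 : 0 <= B := expR_ge0 _.
have exp_ge1 t : 0 <= t -> 1 <= expR (C * t).
  by move=> tt; rewrite -expR0 ler_expR mulr_ge0.
have Bt0 : expR (C * t0) * (1 + X0 ^+ 2) <= B - 1.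
  have -> : B = expR (C * t0) * expR (C * (T' - t0)).
    by rewrite -expRD; congr expR; ring.
  have h1 := exp_ge1 _ t00.
  have h2 : 3 + X0 ^+ 2 <= expR (C * (T' - t0)).
    apply: le_trans (expR_ge1Dx _).
    have : (2 + X0 ^+ 2) <= C * (T' - t0).
      rewrite -ler_pdivrMr // /C lerDr; exact: mulr_ge0.
    lra.
  have := sqr_ge0 X0; nra.
exists (X0 + 1 + B); first by rewrite -addrA lerDl addr_ge0.
(* With this [N], [kappa * expR (- N)] is at most [eta], because [N <= expR N]. *)
move=> kappa eta k0 e0; pose N := kappa / eta.
have N0 : 0 < N by rewrite divr_gt0.
pose q t (x : V) := expR (C * t) * (1 + dot x x).
have hq : has_grad q (fun t x => C * expR (C * t) * (1 + dot x x))
    (fun t x => (2 * expR (C * t)) *: x).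
  apply: has_grad_ext (has_gradM (has_grad_expR (has_gradZ C (has_grad_time R n)))
    (has_gradD (has_grad_cst n 1) (has_grad_sqr R n))) => t x //.
  - by ring.
  - by rewrite !scaler0 addr0 add0r scalerA mulrC.
pose P t x := kappa * expR (N * (q t x - B)).
exists P, (fun t x => P t x * N * (C * expR (C * t) * (1 + dot x x))),
  (fun t x => P t x * N * (2 * expR (C * t))).
have P0 t x : 0 <= P t x by rewrite mulr_ge0 ?expR_ge0 // ltW.
split=> //.
- apply: has_grad_ext (has_gradZ kappa (has_grad_expR (has_gradZ N
    (has_gradB hq (has_grad_cst n B))))) => t x //.
    by rewrite /P; ring.
  by rewrite subr0 !scalerA /P; congr (_ *: _); ring.
- move=> t x tt h; rewrite ler_peMr ?(ltW k0) // -expR0 ler_expR.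
  rewrite mulr_ge0 ?(ltW N0) // subr_ge0 /q -sqr_enorm.
  have h1 := exp_ge1 _ tt; have h2 := sqr_ge0 (enorm x).
  case: h => h.
    have : B <= expR (C * t) by rewrite ler_expR ler_wpM2l.
    nra.
  have : B <= 1 + enorm x ^+ 2 by nra.
  nra.
- move=> x xX; rewrite /P.
  apply: (@le_trans _ _ (kappa * expR (- N))).
    rewrite ler_pM2l // ler_expR -[leRHS]mulrN1 ler_pM2l // lerBlDr addrC.
    apply: le_trans Bt0; rewrite /q -sqr_enorm ler_wpM2l ?expR_ge0 //.
    by rewrite lerD2l ler_pXn2r ?nnegrE ?enorm_ge0.
  rewrite expRN ler_pdivrMr ?expR_gt0 // mulrC -ler_pdivrMr // -/N.
  by apply: le_trans (expR_ge1Dx _); rewrite lerDr.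
- move=> t x; have Pn : 0 <= P t x * N * expR (C * t).
    exact: mulr_ge0 (mulr_ge0 (P0 t x) (ltW N0)) (expR_ge0 _).
  rewrite -sqr_enorm ger0_norm; last first.
    by rewrite [2 * _]mulrC mulrA mulr_ge0.
  set r := enorm x; have r_ge0 : 0 <= r := enorm_ge0 x.
  have h : M * (1 + r) * (2 * r) <= C * (1 + r ^+ 2).
    apply: (@le_trans _ _ (4 * M * (1 + r ^+ 2))).
      have : 0 <= M * (1 + (r - 1) ^+ 2 + r ^+ 2 + 2).
        by rewrite mulr_ge0 // !addr_ge0 ?sqr_ge0.
      rewrite !expr2; nra.
    by rewrite ler_wpM2r // addr_ge0 ?sqr_ge0.
  have := ler_wpM2l Pn h; lra.
Qed.

Definition lipschitz_momentum M (K : V -> V -> R) := forall x p q,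
  K x q - K x p <= M * (1 + enorm x) * enorm (q - p).

Definition lipschitz_position M (H : V -> V -> R) := forall x y p,
  H y p - H x p <= M * (1 + enorm p) * enorm (y - x).

Variables (K1 K2 H : V -> V -> R) (V1 V2 u : R -> V -> R) (M T la mu : R).

(* Each function gets its own time and space variable, because a test function
   touches only one of them; a minimum for large [k] forces [t, s] to be close to
   [r] and [z] to [la *: x + mu *: y]. *)
Definition doubled (P : R -> V -> R) (sig k t : R) (x : V) (s : R) (y : V)
    (r : R) (z : V) : R :=
  V1 t x + V2 s y - u r z + P t x + P s y + sig * r +
  k * ((t - r) ^+ 2 + (s - r) ^+ 2 + enorm (z - (la *: x + mu *: y)) ^+ 2).

Hypotheses (lipK1 : lipschitz_momentum M K1) (lipK2 : lipschitz_momentum M K2)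
  (lipH : lipschitz_position M H)
  (K12H : forall x y p,
    K1 x (la *: p) + K2 y (mu *: p) <= H (la *: x + mu *: y) p)
  (supV1 : supersol K1 T V1) (supV2 : supersol K2 T V2) (subu : subsol H T u).

(** Freezing all but one time-space pair gives one test for each of [V1], [V2] and [u], with momenta
    [la *: p], [mu *: p] (both up to a barrier term) and [p]. When the three inequalities are
    combined, the time penalties cancel, the derivative of [P] absorbs the barrier terms, and [K12H]
    leaves only the change of [H] between [z] and [la *: x + mu *: y]. *)
Lemma doubled_local_min P d c (sig k e t : R) x (s : R) y (r : R) z :
  has_grad P d (fun t x => c t x *: x) ->
  (forall t x, M * (1 + enorm x) * (`|c t x| * enorm x) <= d t x) ->
  0 < t < T -> 0 < s < T -> 0 < r < T -> 0 < e ->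
  (forall t' x' s' y' r' z', `|t' - t| < e -> enorm (x' - x) < e ->
    `|s' - s| < e -> enorm (y' - y) < e -> `|r' - r| < e -> enorm (z' - z) < e ->
    doubled P sig k t x s y r z <= doubled P sig k t' x' s' y' r' z') ->
  sig <= M * (1 + `|2 * k| * enorm (z - (la *: x + mu *: y))) *
    enorm (z - (la *: x + mu *: y)).
Proof.
move=> hP Pd tT sT rT e0 hmin; set Z := enorm _.
set p := (2 * k) *: (z - (la *: x + mu *: y)).
have refl0 : `|t - t| < e /\ `|s - s| < e by rewrite !subrr normr0.
have reflr : `|r - r| < e by rewrite subrr normr0.
have reflV (a : V) : enorm (a - a) < e by rewrite subrr enorm0.
have i1 : 0 <= - (d t x + 2 * k * (t - r)) + K1 x (la *: p - c t x *: x).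
  have hg := has_gradZ (-1) (has_gradD hP (has_gradD
    (has_gradZ k (has_grad_sqr_time n r))
    (has_gradZ k (has_grad_sqr_affine la (mu *: y - z))))).
  have key := supersol_test (x := x) supV1 hg tT; cbv beta in key.
  rewrite [X in K1 x X](_ : _ = la *: p - c t x *: x) in key; last first.
    by apply/rowP => i; rewrite !mxE; ring.
  rewrite [X in X + K1 _ _](_ : _ = - (d t x + 2 * k * (t - r))) in key; last by ring.
  apply: key; exists e; split=> // t' x' h1 h2.
  have := hmin t' x' s y r z h1 h2 refl0.2 (reflV y) reflr (reflV z).
  rewrite /doubled.
  have E a : enorm (z - (la *: a + mu *: y)) = enorm (la *: a + (mu *: y - z)).
    by rewrite -enormN; congr enorm; rewrite opprB addrA.
  rewrite !E; lra.
have i2 : 0 <= - (d s y + 2 * k * (s - r)) + K2 y (mu *: p - c s y *: y).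
  have hg := has_gradZ (-1) (has_gradD hP (has_gradD
    (has_gradZ k (has_grad_sqr_time n r))
    (has_gradZ k (has_grad_sqr_affine mu (la *: x - z))))).
  have key := supersol_test (x := y) supV2 hg sT; cbv beta in key.
  rewrite [X in K2 y X](_ : _ = mu *: p - c s y *: y) in key; last first.
    by apply/rowP => i; rewrite !mxE; ring.
  rewrite [X in X + K2 _ _](_ : _ = - (d s y + 2 * k * (s - r))) in key; last by ring.
  apply: key; exists e; split=> // s' y' h1 h2.
  have := hmin t x s' y' r z refl0.1 (reflV x) h1 h2 reflr (reflV z).
  rewrite /doubled.
  have E a : enorm (z - (la *: x + mu *: a)) = enorm (mu *: a + (la *: x - z)).
    by rewrite -enormN; congr enorm; rewrite opprB addrA (addrC (la *: x)).
  rewrite !E; lra.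
have i3 : sig + 2 * k * (r - t) + 2 * k * (r - s) + H z p <= 0.
  have hg := has_gradD (has_gradZ sig (has_grad_time R n)) (has_gradD (has_gradD
    (has_gradZ k (has_grad_sqr_time n t)) (has_gradZ k (has_grad_sqr_time n s)))
    (has_gradZ k (has_grad_sqr_affine 1 (- (la *: x + mu *: y))))).
  have key hmax := subu rT (has_grad_superdiff (x := z) hg hmax); cbv beta in key.
  rewrite [X in H z X](_ : _ = p) in key; last first.
    by apply/rowP => i; rewrite !mxE; ring.
  rewrite [X in X + H _ _](_ : _ = sig + 2 * k * (r - t) + 2 * k * (r - s)) in key;
    last by ring.
  apply: key; exists e; split=> // r' z' h1 h2.
  have := hmin t x s y r' z' refl0.1 (reflV x) refl0.2 (reflV y) h1 h2.
  rewrite /doubled !scale1r; lra.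
have j1 := lipK1 x (la *: p) (la *: p - c t x *: x).
have j2 := lipK2 y (mu *: p) (mu *: p - c s y *: y).
have nE (a b : V) : enorm (a - b - a) = enorm b.
  by rewrite addrAC subrr sub0r enormN.
rewrite nE enormZ in j1; rewrite nE enormZ in j2.
have j3 := lipH z (la *: x + mu *: y) p.
rewrite enorm_distC /p enormZ -/Z in j3.
have := K12H x y p; have := Pd t x; have := Pd s y; lra.
Qed.

End Comparison.

(** * The three-point comparison principle *)

Section ComparisonPrinciple.
Variables (R : realType) (n : nat).
Local Notation V := 'rV[R]_n.

Definition cylinder (a b : R) (x : V) (r : R) : set (R * V) :=
  [set z | a <= z.1 <= b /\ enorm (z.2 - x) <= r].

Lemma compact_cylinder a b x r : compact (cylinder a b x r).
Proof.
have := compact_setX (@segment_compact R a b) (@compact_eball R n x r).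
rewrite (_ : _ `*` _ = cylinder a b x r) //.
Qed.

Local Notation W := ((R * V) * (R * V) * (R * V))%type.

Lemma doubled_continuous (V1 V2 u P : R -> V -> R) (la mu sig k : R) :
  continuous (fun z : R * V => V1 z.1 z.2) ->
  continuous (fun z : R * V => V2 z.1 z.2) ->
  continuous (fun z : R * V => u z.1 z.2) ->
  continuous (fun z : R * V => P z.1 z.2) ->
  continuous (fun w : W => doubled V1 V2 u la mu P sig k
    w.1.1.1 w.1.1.2 w.1.2.1 w.1.2.2 w.2.1 w.2.2).
Proof.
move=> cV1 cV2 cu cP.
have c1 (T1 T2 : topologicalType) : continuous (@fst T1 T2).
  by move=> w; exact: cvg_fst.
have c2 (T1 T2 : topologicalType) : continuous (@snd T1 T2).
  by move=> w; exact: cvg_snd.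
have p1 : continuous (fun w : W => w.1.1).
  by move=> w; exact: (continuous_comp (c1 _ _ w) (c1 _ _ w.1)).
have p2 : continuous (fun w : W => w.1.2).
  by move=> w; exact: (continuous_comp (c1 _ _ w) (c2 _ _ w.1)).
have p3 : continuous (fun w : W => w.2) by exact: c2.
have cc (S1 S2 S3 : topologicalType) (f : S1 -> S2) (g : S2 -> S3) :
    continuous f -> continuous g -> continuous (fun w => g (f w)).
  by move=> cf cg w; exact: (continuous_comp (cf w) (cg (f w))).
have cst (a : R) : continuous (fun _ : W => a) by exact: cst_continuous.
have ct (p : W -> R * V) : continuous p -> continuous (fun w => (p w).1).
  by move=> cp; apply: cc (c1 _ _).
have cx (p : W -> R * V) : continuous p -> continuous (fun w => (p w).2).
  by move=> cp; apply: cc (c2 _ _).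
have cf (f : R -> V -> R) (p : W -> R * V) :
    continuous (fun z : R * V => f z.1 z.2) -> continuous p ->
    continuous (fun w => f (p w).1 (p w).2).
  by move=> h cp; exact: (cc _ _ _ p (fun z : R * V => f z.1 z.2)).
have csq (f g : W -> R) : continuous f -> continuous g ->
    continuous (fun w => (f w - g w) ^+ 2).
  move=> h1 h2; under eq_fun do rewrite expr2.
  by apply: (@continuous_mul R W); exact: (@continuous_sub R W).
rewrite /doubled.
apply: (@continuous_add R W); last first.
  apply: (@continuous_mul R W); first exact: cst.
  apply: (@continuous_add R W); first apply: (@continuous_add R W).
  - exact: csq (ct _ p1) (ct _ p3).
  - exact: csq (ct _ p2) (ct _ p3).
  - exact: (@continuous_sqr_dist R n W _ _ (cx _ p3)
      (@continuous_lincomb R n W _ _ la mu (cx _ p1) (cx _ p2))).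
apply: (@continuous_add R W); last first.
  by apply: (@continuous_mul R W); [exact: cst | exact: (ct _ p3)].
apply: (@continuous_add R W); last exact: (cf _ _ cP p2).
apply: (@continuous_add R W); last exact: (cf _ _ cP p1).
apply: (@continuous_sub R W); last exact: (cf _ _ cu p3).
by apply: (@continuous_add R W); [exact: (cf _ _ cV1 p1) | exact: (cf _ _ cV2 p2)].
Qed.

Lemma enorm_convex_le (la mu : R) x y (r : R) : 0 <= la -> 0 <= mu ->
  la + mu = 1 -> enorm x <= r -> enorm y <= r ->
  enorm (la *: x + mu *: y : V) <= r.
Proof.
move=> la0 mu0 lamu xr yr; apply: le_trans (enormD _ _) _.
rewrite !enormZ !ger0_norm // -[leRHS]mul1r -lamu mulrDl.
by rewrite lerD // ler_wpM2l.
Qed.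

End ComparisonPrinciple.

(** A positive gap makes the doubled function negative somewhere. Its minimum over a compact
    cylinder is shown to be interior in all six variables, and [doubled_local_min] then bounds [sig]
    by a quantity smaller than [sig]. *)
Lemma comparison_interior (R : realType) (n : nat)
    (K1 K2 H : 'rV[R]_n -> 'rV[R]_n -> R) (V1 V2 u : R -> 'rV[R]_n -> R)
    (M T la mu : R) (M0 : 0 <= M) (la0 : 0 <= la) (mu0 : 0 <= mu)
    (lamu : la + mu = 1) (lipK1 : lipschitz_momentum M K1)
    (lipK2 : lipschitz_momentum M K2) (lipH : lipschitz_position M H)
    (K12H : forall x y p : 'rV[R]_n,
      K1 x (la *: p) + K2 y (mu *: p) <= H (la *: x + mu *: y) p)
    (supV1 : supersol K1 T V1) (supV2 : supersol K2 T V2) (subu : subsol H T u)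
    (cV1 : continuous (fun z : R * 'rV[R]_n => V1 z.1 z.2))
    (cV2 : continuous (fun z : R * 'rV[R]_n => V2 z.1 z.2))
    (cu : continuous (fun z : R * 'rV[R]_n => u z.1 z.2))
    (init : forall x y : 'rV[R]_n, u 0 (la *: x + mu *: y) <= V1 0 x + V2 0 y)
    (t0 : R) (x0 y0 : 'rV[R]_n) :
  0 < t0 -> t0 < T ->
  u t0 (la *: x0 + mu *: y0) <= V1 t0 x0 + V2 t0 y0.
Proof.
move=> t00 t0T; rewrite leNgt; apply/negP => gap.
pose gam := u t0 (la *: x0 + mu *: y0) - (V1 t0 x0 + V2 t0 y0).
have gam0 : 0 < gam by rewrite subr_gt0.
have gamE : gam = u t0 (la *: x0 + mu *: y0) - (V1 t0 x0 + V2 t0 y0) by [].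
clearbody gam.
(* The barrier keeps [t] and [s] below [T1]; the slack up to [T2] leaves room for [r], which is only
   known to be close to them. *)
pose T1 := (t0 + T) / 2; pose T2 := (T1 + T) / 2.
have T1E : 2 * T1 = t0 + T by rewrite /T1; field.
have T2E : 2 * T2 = T1 + T by rewrite /T2; field.
clearbody T1 T2.
have t0T1 : t0 < T1 by clear - T1E t0T; lra.
have T12 : T1 < T2 by clear - T1E T2E t0T; lra.
have T2T : T2 < T by clear - T1E T2E t0T; lra.
have t0T2 : t0 <= T2 := ltW (lt_trans t0T1 T12).
have T20 : 0 <= T2 := le_trans (ltW t00) t0T2.
have T0 : 0 < T := lt_trans t00 t0T.
pose X0 := enorm x0 + enorm y0.
have x0X : enorm x0 <= X0 by rewrite lerDl enorm_ge0.
have y0X : enorm y0 <= X0 by rewrite lerDr enorm_ge0.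
clearbody X0.
have X00 : 0 <= X0 := le_trans (enorm_ge0 _) x0X.
have [r0 r0X bar] := @exists_barrier R n M t0 T1 X0 M0 (ltW t00) t0T1 X00.
have r01 : r0 <= r0 + 1 by rewrite lerDl.
(* One unit beyond [r0]: the barrier confines [x] and [y] to radius [r0], while [z] is only within
   [rho <= 1] of their combination. *)
pose K := cylinder 0 T2 (0 : 'rV[R]_n) (r0 + 1).
have cK : compact K := @compact_cylinder R n 0 T2 0 (r0 + 1).
have inK t x : 0 <= t -> t <= T2 -> enorm x <= r0 + 1 -> K (t, x).
  by move=> h1 h2 h3; split=> /=; rewrite ?h1 // subr0.
have [B1 B10 hB1] := compact_EVT_bound cV1 cK.
have [B2 B20 hB2] := compact_EVT_bound cV2 cK.
have [B3 B30 hB3] := compact_EVT_bound cu cK.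
pose B := B1 + B2 + B3.
have B0 : 0 <= B by rewrite !addr_ge0.
have BE : B = B1 + B2 + B3 by [].
clearbody B.
have e0 : 0 < gam / 8 by rewrite divr_gt0.
(* [B] bounds |V1 + V2 - u| on the cylinder, so a barrier of height [B + 1] excludes a negative
   minimum. *)
have k0 : 0 < B + 1 by rewrite ltr_wpDl.
have [P [d [c [hP P0 Pbig Psmall Pd]]]] := bar _ _ k0 e0.
have [_ _ cP _ _] := hP.
(* The tilt [sig * r] makes the subsolution strict. It costs at most [gam / 4] at [t0], and the two
   barrier values another [gam / 4], which leaves [- gam / 2]. *)
pose sig := gam / (4 * T).
have sig0 : 0 < sig by rewrite divr_gt0 // mulr_gt0.
have sigT : sig * T = gam / 4 by rewrite /sig; field; rewrite gt_eqF.
clearbody sig.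
pose e := Num.min (gam / 8) (sig / (8 * (M + 1))).
have M1 : 0 < M + 1 by rewrite ltr_wpDl.
have ee0 : 0 < e by rewrite lt_min e0 divr_gt0 // mulr_gt0.
have eg : e <= gam / 8 by rewrite ge_min lexx.
have eM : e * (8 * (M + 1)) <= sig.
  by rewrite -ler_pdivlMr ?mulr_gt0 // ge_min lexx orbT.
clearbody e.
have [d1 d10 ud1] := compact_unif_continuous cV1 cK ee0.
have [d2 d20 ud2] := compact_unif_continuous cV2 cK ee0.
have [d3 d30 ud3] := compact_unif_continuous cu cK ee0.
(* [rho] bounds the mismatch of the doubled points. The halves allow for times up to [2 * rho], the
   bound 1 for the extra radius, [T2 - T1] for the final time, and the last entry absorbs M|Z|. *)
pose rho := Num.min (Num.min (Num.min (d1 / 2) (d2 / 2)) (Num.min (d3 / 2) 1))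
  (Num.min (T2 - T1) (sig / (4 * (M + 1)))).
have rho0 : 0 < rho.
  by rewrite !lt_min !divr_gt0 ?mulr_gt0 //= ltr01 subr_gt0 T12.
have : rho <= rho by [].
rewrite {2}/rho !le_min -!andbA => /and5P[rd1 rd2 rd3 r1 /andP[rT rM]].
have {}rM : rho * (4 * (M + 1)) <= sig by rewrite -ler_pdivlMr ?mulr_gt0.
clearbody rho.
(* A mismatch of [rho] would cost [B + 1], more than a negative minimum can afford. *)
pose k := (B + 1) / rho ^+ 2.
have kk0 : 0 < k by rewrite divr_gt0 // exprn_gt0.
have krho : k * rho ^+ 2 = B + 1 by rewrite /k divfK // gt_eqF // exprn_gt0.
clearbody k.
have Xr1 := le_trans r0X r01.
have K0 : K (t0, x0) := inK _ _ (ltW t00) t0T2 (le_trans x0X Xr1).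
have K0' : K (t0, y0) := inK _ _ (ltW t00) t0T2 (le_trans y0X Xr1).
have K0'' : K (t0, la *: x0 + mu *: y0).
  apply: inK _ _ (ltW t00) t0T2 _.
  exact: enorm_convex_le la0 mu0 lamu (le_trans x0X Xr1) (le_trans y0X Xr1).
pose F := doubled V1 V2 u la mu P sig k.
have cF := @doubled_continuous R n V1 V2 u P la mu sig k cV1 cV2 cu cP.
have [] := compact_EVT_min _ (compact_setX (compact_setX cK cK) cK)
  (continuous_subspaceT cF).
  by exists ((t0, x0), (t0, y0), (t0, la *: x0 + mu *: y0)).
move=> [[[t x] [s y]] [r z]]; rewrite inE => -[[/= Kx Ky] Kz] Fmin.
have {}Fmin t' x' s' y' r' z' : K (t', x') -> K (s', y') -> K (r', z') ->
    F t x s y r z <= F t' x' s' y' r' z'.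
  by move=> h1 h2 h3; apply: (Fmin ((t', x'), (s', y'), (r', z'))); rewrite inE.
have F0 : F t x s y r z <= - gam / 2.
  apply: le_trans (Fmin _ _ _ _ _ _ K0 K0' K0'') _.
  rewrite /F /doubled !subrr enorm0 expr0n /= !addr0 mulr0.
  have h1 := Psmall _ x0X; have h2 := Psmall _ y0X.
  have h3 : sig * t0 <= gam / 4 by rewrite -sigT ler_pM2l // ltW.
  by clear - h1 h2 h3 gamE; lra.
have [/= /andP[t_ge0 tT2] xr] := Kx; have [/= /andP[s_ge0 sT2] yr] := Ky.
have [/= /andP[r_ge0 rT2] zr] := Kz; rewrite !subr0 in xr yr zr.
set Z := z - (la *: x + mu *: y).
have kq0 : 0 <= k * ((t - r) ^+ 2 + (s - r) ^+ 2 + enorm Z ^+ 2).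
  by rewrite mulr_ge0 ?(ltW kk0) // !addr_ge0 ?sqr_ge0.
have sr0 : 0 <= sig * r by rewrite mulr_ge0 // ltW.
have := hB1 _ _ Kx; rewrite ler_norml => /andP[b1 _].
have := hB2 _ _ Ky; rewrite ler_norml => /andP[b2 _].
have := hB3 _ _ Kz; rewrite ler_norml => /andP[_ b3]; rewrite /= in b1 b2 b3.
have Px := P0 t x; have Py := P0 s y.
move: F0; rewrite /F /doubled -/Z => F0.
have qB : k * ((t - r) ^+ 2 + (s - r) ^+ 2 + enorm Z ^+ 2) < k * rho ^+ 2.
  by rewrite krho BE; clear - b1 b2 b3 Px Py sr0 F0 gam0; lra.
rewrite ltr_pM2l // in qB.
have sq_lt a : a ^+ 2 < rho ^+ 2 -> `|a| < rho.
  rewrite -(real_normK (num_real a)) ltr_pXn2r ?nnegrE //; exact: ltW.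
have tr : `|t - r| < rho.
  have h1 := sqr_ge0 (s - r); have h2 := sqr_ge0 (enorm Z).
  by apply: sq_lt; clear - h1 h2 qB; lra.
have sr : `|s - r| < rho.
  have h1 := sqr_ge0 (t - r); have h2 := sqr_ge0 (enorm Z).
  by apply: sq_lt; clear - h1 h2 qB; lra.
have Zr : enorm Z < rho.
  rewrite -[enorm Z]ger0_norm ?enorm_ge0 //.
  have h1 := sqr_ge0 (t - r); have h2 := sqr_ge0 (s - r).
  by apply: sq_lt; clear - h1 h2 qB; lra.
have tT1 : t < T1.
  rewrite ltNge; apply/negP => h.
  have {}h := Pbig t x t_ge0 (or_introl h); rewrite BE in h.
  by clear - h b1 b2 b3 Px Py sr0 F0 gam0 kq0; lra.
have sT1 : s < T1.
  rewrite ltNge; apply/negP => h.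
  have {}h := Pbig s y s_ge0 (or_introl h); rewrite BE in h.
  by clear - h b1 b2 b3 Px Py sr0 F0 gam0 kq0; lra.
have xr0 : enorm x < r0.
  rewrite ltNge; apply/negP => h.
  have {}h := Pbig t x t_ge0 (or_intror h); rewrite BE in h.
  by clear - h b1 b2 b3 Px Py sr0 F0 gam0 kq0; lra.
have yr0 : enorm y < r0.
  rewrite ltNge; apply/negP => h.
  have {}h := Pbig s y s_ge0 (or_intror h); rewrite BE in h.
  by clear - h b1 b2 b3 Px Py sr0 F0 gam0 kq0; lra.
move: (tr) (sr); rewrite !ltr_norml => /andP[tr1 tr2] /andP[sr1 sr2].
have rT2' : r < T2 by clear - tr1 tT1 rT; lra.
pose z' := la *: x + mu *: y.
have z'r : enorm z' <= r0 by apply: enorm_convex_le la0 mu0 lamu _ _; exact: ltW.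
have zr0 : enorm z < r0 + 1.
  have := enormD Z z'; rewrite {1}/Z subrK => h.
  by clear - h Zr z'r r1; lra.
have reflt (a : R) : `|a - a| = 0 by rewrite subrr normr0.
have reflV (a : 'rV[R]_n) : enorm (a - a) = 0 by rewrite subrr enorm0.
(* If one of the times vanishes, all are below [2 * rho]. Uniform continuity then carries the three
   values back to time 0, where [init] contradicts the gap. *)
have [pos|npos] := boolP [&& 0 < t, 0 < s & 0 < r]; last first.
  have [ts ss rs] : [/\ t < 2 * rho, s < 2 * rho & r < 2 * rho].
    move: npos; rewrite !negb_and -!leNgt => npos.
    clear - rho0 tr1 tr2 sr1 sr2 npos.
    by case/or3P: npos => h; split; lra.
  have xr0' := ltW (lt_le_trans xr0 r01).
  have yr0' := ltW (lt_le_trans yr0 r01).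
  have td1 : t < d1 by clear - ts rd1; lra.
  have sd2 : s < d2 by clear - ss rd2; lra.
  have rd3' : r < d3 by clear - rs rd3; lra.
  have Zd3 : enorm (z - z') < d3 by clear - Zr rd3 rho0; rewrite -/Z; lra.
  have := ud1 t x 0 x Kx (inK _ _ (lexx 0) T20 xr0').
  rewrite subr0 reflV ger0_norm // => /(_ td1 d10) /=.
  rewrite ltr_norml => /andP[i1 _].
  have := ud2 s y 0 y Ky (inK _ _ (lexx 0) T20 yr0').
  rewrite subr0 reflV ger0_norm // => /(_ sd2 d20) /=.
  rewrite ltr_norml => /andP[i2 _].
  have := ud3 r z 0 z' Kz (inK _ _ (lexx 0) T20 (le_trans z'r r01)).
  rewrite subr0 ger0_norm // => /(_ rd3' Zd3) /=.
  rewrite ltr_norml => /andP[_ i3].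
  have := init x y; rewrite -/z' => i4.
  by clear - i1 i2 i3 i4 F0 eg Px Py sr0 kq0 gam0; lra.
move/and3P: pos => [t_gt0 s_gt0 r_gt0].
(* Replacing [z] by [z'] removes the space penalty and changes nothing else but [u]; minimality
   bounds the penalty by that change. *)
have kZ : k * enorm Z ^+ 2 < e.
  have Kz' : K (r, z') := inK _ _ r_ge0 rT2 (le_trans z'r r01).
  have := Fmin t x s y r z' Kx Ky Kz'; rewrite /F /doubled reflV -/Z => h0.
  have Zd3 : enorm (z - z') < d3 by clear - Zr rd3 rho0; rewrite -/Z; lra.
  have := ud3 r z r z' Kz Kz'; rewrite reflt => /(_ d30 Zd3) /=.
  rewrite ltr_norml => /andP[_ i3].
  by clear - h0 i3; rewrite expr0n /= in h0; lra.
pose m1 := Num.min (Num.min t s) r.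
pose m2 := Num.min (Num.min (T2 - t) (T2 - s)) (T2 - r).
pose m3 := Num.min (Num.min (r0 - enorm x) (r0 - enorm y)) (r0 + 1 - enorm z).
pose m := Num.min (Num.min m1 m2) m3.
have m0 : 0 < m.
  rewrite !lt_min t_gt0 s_gt0 r_gt0 !subr_gt0 xr0 yr0 zr0 rT2' /= !andbT.
  by rewrite (lt_trans tT1 T12) (lt_trans sT1 T12).
have : m <= m by [].
rewrite {2}/m /m1 /m2 /m3 !le_min => /andP[/andP[/andP[/andP[m11 m12] m13]
  /andP[/andP[m21 m22] m23]] /andP[/andP[m31 m32] m33]].
clearbody m.
have inK' (a a' b : R) (p p' : 'rV[R]_n) : m <= a -> m <= T2 - a -> m <= b - enorm p ->
    b <= r0 + 1 -> `|a' - a| < m -> enorm (p' - p) < m -> K (a', p').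
  move=> h1 h2 h3 h4; rewrite ltr_norml => /andP[h5 h6] h7.
  have := enormD (p' - p) p; rewrite subrK => h8.
  by apply: inK; [clear - h1 h5 | clear - h2 h6 | clear - h3 h4 h7 h8]; lra.
have := @doubled_local_min R n K1 K2 H V1 V2 u M T la mu lipK1 lipK2 lipH K12H
  supV1 supV2 subu P d c sig k m t x s y r z hP Pd.
have -> : 0 < t < T by rewrite t_gt0 (lt_trans (lt_trans tT1 T12) T2T).
have -> : 0 < s < T by rewrite s_gt0 (lt_trans (lt_trans sT1 T12) T2T).
have -> : 0 < r < T by rewrite r_gt0 (lt_trans rT2' T2T).
move=> /(_ isT isT isT m0) h.
have {h} : sig <= M * (1 + `|2 * k| * enorm Z) * enorm Z.
  apply: h => t' x' s' y' r' z'' h1 h2 h3 h4 h5 h6.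
  apply: Fmin.
  - by apply: (inK' t t' r0 x x').
  - by apply: (inK' s s' r0 y y').
  - by apply: (inK' r r' (r0 + 1) z z'').
rewrite gtr0_norm ?mulr_gt0 //.
have -> : M * (1 + 2 * k * enorm Z) * enorm Z =
  M * enorm Z + 2 * (M * (k * enorm Z ^+ 2)) by ring.
move=> h0.
have h1 : M * enorm Z <= (M + 1) * rho.
  by rewrite ler_pM ?enorm_ge0 // ?(ltW Zr) // lerDl.
have h2 : M * (k * enorm Z ^+ 2) <= (M + 1) * e.
  apply: ler_pM; rewrite ?lerDl //; last exact: ltW.
  by rewrite mulr_ge0 ?sqr_ge0 // ltW.
by clear - h0 h1 h2 rM eM sig0; lra.
Qed.

(** The equation is only assumed before [T], so the final time is reached by continuity from
    slightly earlier times. *)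
Lemma comparison (R : realType) (n : nat)
    (K1 K2 H : 'rV[R]_n -> 'rV[R]_n -> R) (V1 V2 u : R -> 'rV[R]_n -> R)
    (M T la mu : R) (M0 : 0 <= M) (la0 : 0 <= la) (mu0 : 0 <= mu)
    (lamu : la + mu = 1) (lipK1 : lipschitz_momentum M K1)
    (lipK2 : lipschitz_momentum M K2) (lipH : lipschitz_position M H)
    (K12H : forall x y p : 'rV[R]_n,
      K1 x (la *: p) + K2 y (mu *: p) <= H (la *: x + mu *: y) p)
    (supV1 : supersol K1 T V1) (supV2 : supersol K2 T V2) (subu : subsol H T u)
    (cV1 : continuous (fun z : R * 'rV[R]_n => V1 z.1 z.2))
    (cV2 : continuous (fun z : R * 'rV[R]_n => V2 z.1 z.2))
    (cu : continuous (fun z : R * 'rV[R]_n => u z.1 z.2))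
    (init : forall x y : 'rV[R]_n, u 0 (la *: x + mu *: y) <= V1 0 x + V2 0 y)
    (t0 : R) (x0 y0 : 'rV[R]_n) :
  0 <= t0 <= T ->
  u t0 (la *: x0 + mu *: y0) <= V1 t0 x0 + V2 t0 y0.
Proof.
move=> /andP[t00 t0T].
have [->|t0n] := eqVneq t0 0; first exact: init.
have {t0n}t0_gt0 : 0 < t0 by rewrite lt_neqAle eq_sym t0n.
have [t0lt|t0ge] := ltP t0 T.
  exact: (@comparison_interior R n K1 K2 H V1 V2 u M T la mu).
rewrite leNgt; apply/negP => gap.
pose gam := u t0 (la *: x0 + mu *: y0) - (V1 t0 x0 + V2 t0 y0).
have gam0 : 0 < gam / 3 by rewrite divr_gt0 // subr_gt0.
have [d1 d10 h1] := continuous_enorm t0 x0 cV1 gam0.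
have [d2 d20 h2] := continuous_enorm t0 y0 cV2 gam0.
have [d3 d30 h3] := continuous_enorm t0 (la *: x0 + mu *: y0) cu gam0.
pose dm := Num.min (Num.min d1 d2) (Num.min d3 t0).
have dm0 : 0 < dm by rewrite !lt_min d10 d20 d30.
have : dm <= dm by [].
rewrite {2}/dm !le_min -andbA => /and4P[e1 e2 e3 e4]; clearbody dm.
pose dd := dm / 2; have ddE : dm = 2 * dd by rewrite /dd; field.
clearbody dd.
have ts : `|t0 - dd - t0| = dd.
  rewrite addrAC subrr sub0r normrN gtr0_norm //; clear - dm0 ddE; lra.
have reflV (a : 'rV[R]_n) : enorm (a - a) = 0 by rewrite subrr enorm0.
have f1 : dd < d1 by clear - dm0 ddE e1; lra.
have f2 : dd < d2 by clear - dm0 ddE e2; lra.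
have f3 : dd < d3 by clear - dm0 ddE e3; lra.
have f4 : 0 < t0 - dd by clear - dm0 ddE e4; lra.
have f5 : t0 - dd < T by clear - dm0 ddE t0T; lra.
have := @comparison_interior R n K1 K2 H V1 V2 u M T la mu M0 la0 mu0 lamu
  lipK1 lipK2 lipH K12H supV1 supV2 subu cV1 cV2 cu init _ x0 y0 f4 f5.
have := h1 (t0 - dd) x0; have := h2 (t0 - dd) y0.
have := h3 (t0 - dd) (la *: x0 + mu *: y0).
rewrite ts !reflV /= => /(_ f3 d30) + /(_ f2 d20) + /(_ f1 d10).
rewrite !ltr_norml => /andP[j3 _] /andP[_ j2] /andP[_ j1] j4.
by clear - j1 j2 j3 j4; rewrite /gam in j1 j2 j3; lra.
Qed.

(** * From forward to backward inequalities for solutions convex in space *)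

(** If [a < - H x b], then just after [t] the function [u] at [x] falls below the affine function of
    slope [b] descending at rate [G], slightly more than [H x b]. At time [t] that function supports
    [u] from below, so a perturbation of it touches [u] from below strictly later, with momentum
    close to [b], against the supersolution property. *)
Lemma superdiff_backward (R : realType) (n : nat) (H : 'rV[R]_n -> 'rV[R]_n -> R)
    (u : R -> 'rV[R]_n -> R) (M T t : R) (x : 'rV[R]_n) (a : R) (b : 'rV[R]_n) :
  0 <= M -> lipschitz_momentum M H -> lipschitz_position M H ->
  supersol H T u -> continuous (fun z : R * 'rV[R]_n => u z.1 z.2) ->
  convex_fun (u t) -> 0 < t < T -> superdiff u t x a b -> 0 <= a + H x b.
Proof.
move=> M0 lipp lipx supu cu cvu /andP[t0 tT] hab.
rewrite leNgt; apply/negP => neg.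
pose eta := - (a + H x b) / 3.
have aE : a = - H x b - 3 * eta by rewrite /eta; field.
have eta0 : 0 < eta by clear - aE neg; lra.
clearbody eta.
pose G := H x b + eta.
have subg y := superdiff_convex_subgradient y cvu hab.
have [r1 r10 hr1] := superdiff_expansion hab eta0.
(* Sum of the position error M(3+|b|), for momenta within 2 of [b], and of the momentum error
   2M(1+|x|), each per unit of [r]. *)
pose A := M * (5 + enorm b + 2 * enorm x).
have A0 : 0 <= A by rewrite mulr_ge0 // !addr_ge0 ?mulr_ge0 ?enorm_ge0.
have A1 : 0 < A + 1 by rewrite ltr_wpDl.
pose r := Num.min 1 (eta / (A + 1)).
have r0 : 0 < r by rewrite lt_min ltr01 divr_gt0.
have rle1 : r <= 1 by rewrite ge_min lexx.
have Ar : A * r < eta.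
  have : r * (A + 1) <= eta by rewrite -ler_pdivlMr // ge_min lexx orbT.
  by clear - r0; lra.
clearbody r.
have Hnear y : enorm (y - x) <= r -> H y (b - 2 *: (y - x)) < H x b + eta.
  move=> yr; set q := b - _.
  have h1 := lipx x y q; have h2 := lipp x b q.
  have h3 : enorm (q - b) <= 2 * r.
    rewrite /q addrAC subrr sub0r enormN enormZ gtr0_norm //.
    by rewrite ler_pM2l.
  have h4 : enorm q <= enorm b + 2.
    have := enormD b (q - b); rewrite addrC subrK => h.
    by clear - h h3 rle1; lra.
  have h5 : M * (1 + enorm q) * enorm (y - x) <= M * (3 + enorm b) * r.
    apply: ler_pM; rewrite ?enorm_ge0 ?mulr_ge0 ?addr_ge0 ?enorm_ge0 //.
    by rewrite ler_wpM2l //; clear - h4; lra.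
  have h6 : M * (1 + enorm x) * enorm (q - b) <= M * (1 + enorm x) * (2 * r).
    by rewrite ler_wpM2l // mulr_ge0 ?addr_ge0 ?enorm_ge0.
  by move: Ar; rewrite /A; clear - h1 h2 h5 h6; lra.
have q0 : 0 < r ^+ 2 / 4 by rewrite divr_gt0 // exprn_gt0.
pose T' := (t + T) / 2.
have tT' : t < T' by rewrite /T'; clear - tT; lra.
have T'T : T' < T by rewrite /T'; clear - tT; lra.
clearbody T'.
have [dl dl0 hdl] := compact_unif_continuous cu (@compact_cylinder R n t T' x r) q0.
have G1 : 0 < 4 * (`|G| + 1) by rewrite mulr_gt0 // ltr_wpDl.
(* Short enough that the change of [u] in time and the drift [(s - t) * G] each lose at most
   [r ^+ 2 / 4]; together they stay below the penalty [r ^+ 2] on the side and on the top of the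
   cylinder. *)
pose h := Num.min (Num.min (dl / 2) (T' - t)) (r ^+ 2 / (4 * (`|G| + 1))).
have h0 : 0 < h by rewrite !lt_min !divr_gt0 ?exprn_gt0 //= subr_gt0 tT'.
have : h <= h by [].
rewrite {2}/h !le_min => /andP[/andP[hd hT'] hG]; clearbody h.
have {}hG s : t <= s -> s <= t + h -> - (r ^+ 2 / 4) <= (s - t) * G.
  move=> ts sh; have st : 0 <= s - t by rewrite subr_ge0.
  have h1 : h * (4 * (`|G| + 1)) <= r ^+ 2 by rewrite -ler_pdivlMr.
  have h2 : (s - t) * `|G| <= h * (`|G| + 1).
    by apply: ler_pM => //; [clear - sh; lra | rewrite lerDl].
  have h3 : - ((s - t) * `|G|) <= (s - t) * G.
    by rewrite -mulrN ler_wpM2l // lerNl -normrN ler_norm.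
  by clear - h1 h2 h3; lra.
have ulow s y : t <= s -> s <= t + h -> enorm (y - x) <= r ->
    u t x + dot b (y - x) - r ^+ 2 / 4 <= u s y.
  move=> ts sh yr.
  have Ks : cylinder t T' x r (s, y).
    by split=> //=; rewrite ts /=; clear - sh hT'; lra.
  have Kt : cylinder t T' x r (t, y) by split=> //=; rewrite lexx ltW.
  have := hdl s y t y Ks Kt; rewrite subrr enorm0.
  have -> : `|s - t| < dl.
    by rewrite ger0_norm ?subr_ge0 //; clear - sh hd dl0; lra.
  move=> /(_ isT dl0) /=; rewrite ltr_norml => /andP[h1 _].
  by have h2 := subg y; clear - h1 h2; lra.
pose kap := r ^+ 2 / h ^+ 2.
have kap0 : 0 < kap by rewrite divr_gt0 // exprn_gt0.
have kapE : kap * h ^+ 2 = r ^+ 2 by rewrite /kap divfK // gt_eqF // exprn_gt0.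
clearbody kap.
pose F s y := u s y -
  (dot b y - (G * s + (enorm (1 *: y - x) ^+ 2 + kap * (s - t) ^+ 2))).
pose F0 := u t x - dot b x + G * t.
have FE s y : F s y - F0 = (u s y - u t x) - dot b (y - x) + (s - t) * G
    + enorm (y - x) ^+ 2 + kap * (s - t) ^+ 2.
  by rewrite /F /F0 scale1r dotBr; ring.
have cF : continuous (fun z : R * 'rV[R]_n => F z.1 z.2).
  have c1 : continuous (fun z : R * 'rV[R]_n => z.1) by move=> z; exact: cvg_fst.
  have [_ _ c _ _] := has_gradB (has_grad_lin b) (has_gradD
    (has_gradZ G (has_grad_time R n)) (has_gradD (has_grad_sqr_affine 1 (- x))
    (has_gradZ kap (has_grad_sqr_time n t)))).
  exact: continuous_sub.
have Kx s : t <= s <= t + h -> cylinder t (t + h) x r (s, x).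
  by move=> ts; split=> //=; rewrite subrr enorm0 ltW.
have [] := compact_EVT_min _ (@compact_cylinder R n t (t + h) x r)
  (continuous_subspaceT cF).
  by exists (t, x); apply: Kx; rewrite lexx lerDl ltW.
move=> [s y]; rewrite inE => -[/= /andP[ts sh] yr] Fmin.
have {}Fmin s' y' : cylinder t (t + h) x r (s', y') -> F s y <= F s' y'.
  by move=> K; apply: (Fmin (s', y')); rewrite inE.
(* At [(t + m, x)] the expansion gives a drop of [m * eta], against a time penalty of only
   [kap * m ^+ 2]. The bottom is thereby excluded, since there [F] is at least [F0]. *)
have Fneg : F s y < F0.
  pose m := Num.min (Num.min r1 h) (eta / kap) / 2.
  have mm : 0 < Num.min (Num.min r1 h) (eta / kap).
    by rewrite !lt_min r10 h0 divr_gt0.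
  have m0 : 0 < m by rewrite divr_gt0.
  have mE : Num.min (Num.min r1 h) (eta / kap) = 2 * m by rewrite /m; field.
  have : 2 * m <= Num.min (Num.min r1 h) (eta / kap) by rewrite mE.
  rewrite !le_min => /andP[/andP[mr mh] mk].
  have {mk}mk : kap * m < eta.
    by move: mk; rewrite ler_pdivlMr // => mk; have := mulr_gt0 m0 kap0;
      clear - mk; lra.
  have Km : cylinder t (t + h) x r (t + m, x).
    by apply: Kx; apply/andP; split; clear - m0 mh; lra.
  apply: le_lt_trans (Fmin _ _ Km) _.
  rewrite -subr_lt0 FE subrr dot0r enorm0 expr0n /= addr0 subr0.
  have tm : t + m - t = m by rewrite addrAC subrr add0r.
  have := hr1 (t + m) x; rewrite tm subrr enorm0 dot0r gtr0_norm // => e1.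
  have {}e1 : u (t + m) x <= u t x + m * a + 0 + eta * (m + 0).
    by apply: e1 => //; clear - mr m0; lra.
  have := ltr_pM2l m0 (kap * m) eta; rewrite mk => e2.
  by move: e1 e2; rewrite aE /G expr2; clear; lra.
have tlts : t < s.
  rewrite lt_neqAle ts andbT; apply/eqP => E; move: Fneg.
  rewrite -subr_lt0 FE -E subrr mul0r expr0n mulr0 !addr0.
  have := subg y; have := sqr_ge0 (enorm (y - x)); clear; lra.
have hGs := hG s ts sh; have ul := ulow s y ts sh yr.
have slt : s < t + h.
  rewrite lt_neqAle sh andbT; apply/eqP => E; move: Fneg.
  have sth : s - t = h by rewrite E addrAC subrr add0r.
  rewrite -subr_lt0 FE sth kapE; move: hGs; rewrite sth.
  by have := sqr_ge0 (enorm (y - x)); clear - ul q0; lra.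
have yltr : enorm (y - x) < r.
  rewrite lt_neqAle yr andbT; apply/eqP => E; move: Fneg.
  rewrite -subr_lt0 FE E.
  by have := mulr_ge0 (ltW kap0) (sqr_ge0 (s - t)); clear - ul hGs q0; lra.
have hg := has_gradB (has_grad_lin b) (has_gradD
    (has_gradZ G (has_grad_time R n)) (has_gradD (has_grad_sqr_affine 1 (- x))
    (has_gradZ kap (has_grad_sqr_time n t)))).
have sT : 0 < s < T.
  by apply/andP; split; [exact: lt_trans t0 tlts | clear - slt hT' T'T; lra].
have key := supersol_test (x := y) supu hg sT; cbv beta in key.
rewrite [X in H y X](_ : _ = b - 2 *: (y - x)) in key; last first.
  by apply/rowP => i; rewrite !mxE; ring.
rewrite [X in X + H _ _](_ : _ = - G - 2 * kap * (s - t)) in key; last by ring.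
have hy := Hnear y yr.
have kst : 0 <= kap * (s - t) by rewrite mulr_ge0 ?subr_ge0 // ltW.
have : 0 <= - G - 2 * kap * (s - t) + H y (b - 2 *: (y - x)).
  apply: key.
  pose m := Num.min (Num.min (s - t) (t + h - s)) (r - enorm (y - x)).
  have m0 : 0 < m by rewrite !lt_min !subr_gt0 tlts slt.
  exists m; split=> // s' y'; rewrite !lt_min => /andP[/andP[k1 k2] _].
  move=> /andP[_ k3]; apply: Fmin; split=> /=; last first.
    have := enorm_le_sum y' y x; clear - k3; lra.
  move: k1 k2; rewrite !ltr_norml => /andP[k1 _] /andP[_ k2].
  by apply/andP; split; clear - k1 k2; lra.
by move: hy kst; rewrite /G; clear; lra.
Qed.

(** The subdifferential makes [u] grow along the line of velocity [v] at a rate above [c]. A test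
    function of rate [c], penalising the distance to the moving point, then touches [u] from above
    with an uncontrolled momentum [p]. Its time derivative contains [- dot v p], which cancels the
    linear term of the lower bound of [H x p] given by [v]. *)
Lemma subdiff_backward (R : realType) (n : nat) (H : 'rV[R]_n -> 'rV[R]_n -> R)
    (u : R -> 'rV[R]_n -> R) (M T t : R) (x : 'rV[R]_n) (a : R) (b : 'rV[R]_n) :
  0 <= M -> lipschitz_momentum M H -> lipschitz_position M H ->
  convex_fun (H x) ->
  subsol H T u -> continuous (fun z : R * 'rV[R]_n => u z.1 z.2) ->
  (forall s, 0 < s < T -> convex_fun (u s)) ->
  0 < t < T -> subdiff u t x a b -> a + H x b <= 0.
Proof.
move=> M0 lipp lipx cvH subu cu cvu /andP[t0 tT] hab.
rewrite leNgt; apply/negP => pos.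
pose eta := (a + H x b) / 4.
have aE : a = 4 * eta - H x b by rewrite /eta; field.
have eta0 : 0 < eta by rewrite divr_gt0.
clearbody eta.
have Mx0 : 0 <= M * (1 + enorm x) by rewrite mulr_ge0 ?addr_ge0 ?enorm_ge0.
have [v hv] := approx_subgradient b cvH Mx0 (lipp x) eta0.
pose T' := (t + T) / 2.
have tT' : t < T' by rewrite /T'; clear - tT; lra.
have T'T : T' < T by rewrite /T'; clear - tT; lra.
clearbody T'.
have [B B0 hB] := compact_EVT_bound cu (@compact_cylinder R n t T' x 2).
have {}hB s y : t <= s -> s <= T' -> enorm (y - x) <= 2 -> - B <= u s y <= B.
  by move=> h1 h2 h3; rewrite -ler_norml; apply: hB; split=> //=; rewrite h1.
(* A subgradient [p] raises [u] by at least its own norm over a unit step in its direction. The step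
   stays in the ball of radius 2, where |u| is at most [B]. *)
have gradB s y d p : t < s -> s < T' -> enorm (y - x) <= 1 ->
    superdiff u s y d p -> enorm p <= 2 * B.
  move=> ts sT' yx hs.
  have [p0|p0] := eqVneq (enorm p) 0; first by rewrite p0 mulr_ge0.
  have pp : 0 < enorm p by rewrite lt_neqAle eq_sym p0 enorm_ge0.
  have sT : 0 < s < T by rewrite (lt_trans t0 ts) (lt_trans sT' T'T).
  have := superdiff_convex_subgradient (y + (enorm p)^-1 *: p) (cvu s sT) hs.
  rewrite [y + _]addrC addrK dotZr -sqr_enorm expr2 mulKf //.
  set y' := _ + y => h1.
  have y'2 : enorm (y' - x) <= 2.
    have := enorm_le_sum y' y x; rewrite {2}/y' addrK enormZ.
    by rewrite gtr0_norm ?invr_gt0 // mulVf //; clear - yx; lra.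
  have /andP[_ h2] := hB s y' (ltW ts) (ltW sT') y'2.
  have y2 : enorm (y - x) <= 2 by clear - yx; lra.
  have /andP[h3 _] := hB s y (ltW ts) (ltW sT') y2.
  by clear - h1 h2 h3; lra.
pose A := M * (1 + 2 * B).
have A0 : 0 <= A by rewrite mulr_ge0 // addr_ge0 // mulr_ge0.
have A1 : 0 < A + 1 by rewrite ltr_wpDl.
pose r := Num.min 1 (eta / (A + 1)).
have r0 : 0 < r by rewrite lt_min ltr01 divr_gt0.
have rle1 : r <= 1 by rewrite ge_min lexx.
have Ar : A * r <= eta.
  have : r * (A + 1) <= eta by rewrite -ler_pdivlMr // ge_min lexx orbT.
  by clear - r0; lra.
clearbody r.
(* The growth rate along the line is [a + dot b v = c + eta]. Of the [3 * eta] in [c], one goes to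
   the approximate subgradient, one to the position error, and one remains for the contradiction. *)
pose c := dot v b - H x b + 3 * eta.
have v1 : 0 < 2 * (enorm v + 1) by rewrite mulr_gt0 // ltr_wpDl ?enorm_ge0.
pose h := Num.min (T' - t) (r / (2 * (enorm v + 1))).
have h0 : 0 < h by rewrite lt_min subr_gt0 tT' divr_gt0.
have hT' : t + h <= T' by rewrite -lerBrDl ge_min lexx.
have vh : enorm v * h <= r / 2.
  have : h * (2 * (enorm v + 1)) <= r by rewrite -ler_pdivlMr // ge_min lexx orbT.
  by clear - h0; lra.
clearbody h.
have vst s : t <= s -> s <= t + h -> enorm ((s - t) *: v) <= r / 2.
  move=> ts sh; rewrite enormZ ger0_norm ?subr_ge0 // mulrC.
  by apply: le_trans vh; rewrite ler_wpM2l ?enorm_ge0 // lerBlDl.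
(* More than the oscillation of [u] and the linear term can contribute together, hence the price of
   touching the top or the side. *)
pose D := 2 * B + `|c| * h + 1.
have D0 : 0 < D by rewrite ltr_wpDl // addr_ge0 ?mulr_ge0 // ltW.
have cst s : t <= s -> s <= t + h -> - (`|c| * h) <= c * (s - t).
  move=> ts sh; have st : 0 <= s - t by rewrite subr_ge0.
  apply: (@le_trans _ _ (- `|c| * (s - t))); last first.
    by rewrite ler_wpM2r // lerNl -normrN ler_norm.
  by rewrite mulNr lerN2 ler_wpM2l // lerBlDl.
pose kap := D / h ^+ 2.
have kap0 : 0 < kap by rewrite divr_gt0 // exprn_gt0.
have kapE : kap * h ^+ 2 = D by rewrite /kap divfK // gt_eqF // exprn_gt0.
clearbody kap.
have ev0 : 0 < eta / (2 * (enorm v + 1)) by rewrite divr_gt0.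
have [r2 r20 hr2] := subdiff_expansion hab ev0.
have [m [m0 mh mr mv mk]] : exists m : R,
    [/\ 0 < m, m <= h, m < r2, enorm v * m < r2 & kap * m <= eta / 4].
  pose m := Num.min (Num.min h (eta / 4 / kap)) (r2 / (2 * (enorm v + 1))).
  have m0 : 0 < m by rewrite !lt_min h0 !divr_gt0.
  have : m <= m by [].
  rewrite {2}/m !le_min => /andP[/andP[mh]]; clearbody m.
  rewrite !ler_pdivlMr // => mk mr.
  have vm : 0 <= enorm v * m by rewrite mulr_ge0 ?enorm_ge0 // ltW.
  exists m; split=> //; first by clear - mr m0 vm; lra.
    by clear - mr m0 vm; lra.
  by rewrite mulrC ler_pdivlMr.
(* A lower bound for the maximum above [F0], obtained on the line, where the space penalty vanishes;
   it is thus fixed before [k]. *)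
pose al := m * eta / 4.
have al0 : 0 < al by rewrite divr_gt0 // mulr_gt0.
have um : u t x + m * (c + eta / 2) <= u (t + m) (x + m *: v).
  have := hr2 (t + m) (x + m *: v).
  have tm : t + m - t = m by rewrite addrAC subrr add0r.
  have xm : x + m *: v - x = m *: v by rewrite addrAC subrr add0r.
  rewrite tm xm enormZ gtr0_norm // [m * enorm v]mulrC => /(_ mr mv).
  rewrite dotZr; apply: le_trans.
  have -> : eta / (2 * (enorm v + 1)) * (m + enorm v * m) = m * (eta / 2).
    by field; rewrite gt_eqF // ltr_wpDl ?enorm_ge0.
  by rewrite /c aE (dotC b v); clear; lra.
have [d3 d30 hd3] := continuous_enorm t x cu al0.
(* The first term excludes the bottom beyond distance [d3] (nearer, [u] rises by less than [al]).
   The second excludes the side, whose points are at least [r / 2] away from the line. *)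
pose k := D / d3 ^+ 2 + 4 * D / r ^+ 2.
have kd : D <= k * d3 ^+ 2.
  rewrite /k mulrDl divfK ?gt_eqF ?exprn_gt0 // lerDl.
  by rewrite mulr_ge0 ?divr_ge0 ?mulr_ge0 ?sqr_ge0 // ltW.
have kr : 4 * D <= k * r ^+ 2.
  have E : 4 * D / r ^+ 2 * r ^+ 2 = 4 * D.
    by rewrite divfK // gt_eqF // exprn_gt0.
  rewrite /k [leRHS]mulrDl E lerDr.
  by rewrite mulr_ge0 ?divr_ge0 ?sqr_ge0 // ltW.
have k0 : 0 < k by rewrite addr_gt0 ?divr_gt0 ?mulr_gt0 ?exprn_gt0.
clearbody k.
pose F s y := u s y - (c * s + (k * enorm (y - (x + (s - t) *: v)) ^+ 2
  + kap * (s - t) ^+ 2)).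
pose F0 := u t x - c * t.
have hg := has_gradD (has_gradZ c (has_grad_time R n)) (has_gradD
    (has_gradZ k (has_grad_sqr_moving t x v))
    (has_gradZ kap (has_grad_sqr_time n t))).
have FE s y : F s y - F0 = (u s y - u t x) - c * (s - t)
    - k * enorm (y - (x + (s - t) *: v)) ^+ 2 - kap * (s - t) ^+ 2.
  by rewrite /F /F0; ring.
have cF : continuous (fun z : R * 'rV[R]_n => F z.1 z.2).
  by have [_ _ c1 _ _] := hg; exact: continuous_sub.
have inK s y : t <= s -> s <= t + h -> enorm (y - x) <= r ->
  cylinder t (t + h) x r (s, y) by move=> h1 h2 h3; split=> //=; rewrite h1.
have Km : cylinder t (t + h) x r (t + m, x + m *: v).
  apply: inK; rewrite ?lerDl ?lerD2l ?(ltW m0) //.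
  rewrite addrAC subrr add0r enormZ gtr0_norm // mulrC.
  have : enorm v * m <= enorm v * h by rewrite ler_wpM2l ?enorm_ge0.
  by clear - vh r0; lra.
have [] := compact_EVT_max _ (@compact_cylinder R n t (t + h) x r)
  (continuous_subspaceT cF); first by eexists; exact: Km.
move=> [s y]; rewrite inE => -[/= /andP[ts sh] yr] Fmax.
have {}Fmax s' y' : cylinder t (t + h) x r (s', y') -> F s' y' <= F s y.
  by move=> K; apply: (Fmax (s', y')); rewrite inE.
have Fpos : al <= F s y - F0.
  apply: le_trans (lerB (Fmax _ _ Km) (lexx F0)).
  have tm : t + m - t = m by rewrite addrAC subrr add0r.
  rewrite FE tm subrr enorm0 expr0n /= mulr0 subr0.
  have := ler_wpM2l (ltW m0) mk; move: um; rewrite /al expr2; clear; lra.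
have sT' : s <= T' := le_trans sh hT'.
have y2 : enorm (y - x) <= 2 by clear - yr rle1; lra.
have /andP[_ uB] := hB s y ts sT' y2.
have /andP[uxB _] : - B <= u t x <= B.
  by apply: hB; rewrite ?subrr ?enorm0 // ltW.
have cs := cst s ts sh.
have kq := mulr_ge0 (ltW k0) (sqr_ge0 (enorm (y - (x + (s - t) *: v)))).
have kapq := mulr_ge0 (ltW kap0) (sqr_ge0 (s - t)).
rewrite FE in Fpos.
have tlts : t < s.
  rewrite lt_neqAle ts andbT; apply/eqP => E; move: Fpos.
  rewrite -E subrr scale0r addr0 mulr0 expr0n mulr0 !subr0.
  have [yd|yd] := ltP (enorm (y - x)) d3.
    have := hd3 t y; rewrite subrr normr0 => /(_ d30 yd) /=.
    rewrite ltr_norml => /andP[_ h1].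
    have := mulr_ge0 (ltW k0) (sqr_ge0 (enorm (y - x))).
    by clear - h1; lra.
  have h1 : d3 ^+ 2 <= enorm (y - x) ^+ 2.
    by rewrite ler_pXn2r ?nnegrE ?enorm_ge0 // ltW.
  have := ler_wpM2l (ltW k0) h1; move: kd uB; rewrite /D -E.
  have := mulr_ge0 (normr_ge0 c) (ltW h0).
  by clear - uxB al0; lra.
have slt : s < t + h.
  rewrite lt_neqAle sh andbT; apply/eqP => E; move: Fpos cs.
  have -> : s - t = h by rewrite E addrAC subrr add0r.
  have := mulr_ge0 (ltW k0) (sqr_ge0 (enorm (y - (x + h *: v)))).
  by rewrite kapE /D; clear - uB uxB al0; lra.
have yltr : enorm (y - x) < r.
  rewrite lt_neqAle yr andbT; apply/eqP => E; move: Fpos.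
  have h1 : r / 2 <= enorm (y - (x + (s - t) *: v)).
    have := enormD (y - (x + (s - t) *: v)) ((s - t) *: v).
    rewrite opprD addrA subrK E; have := vst s ts sh; clear; lra.
  have h2 : (r / 2) ^+ 2 <= enorm (y - (x + (s - t) *: v)) ^+ 2.
    by rewrite ler_pXn2r ?nnegrE ?enorm_ge0 // ltW // divr_gt0.
  have := ler_wpM2l (ltW k0) h2; move: kr.
  have -> : k * (r / 2) ^+ 2 = k * r ^+ 2 / 4 by field.
  by rewrite /D; clear - uB uxB al0 kapq cs; lra.
have sT : 0 < s < T.
  by rewrite (lt_trans t0 tlts) (le_lt_trans sT' T'T).
set p := (2 * k) *: (y - (x + (s - t) *: v)).
pose d := c - dot v p + 2 * kap * (s - t).
have sd : superdiff u s y d p.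
  have := @has_grad_superdiff R n u _ _ _ s y hg; cbv beta.
  rewrite [X in superdiff _ _ _ _ X](_ : _ = p); last first.
    by apply/rowP => i; rewrite !mxE; ring.
  rewrite [X in superdiff _ _ _ X](_ : _ = d); last first.
    by rewrite /d /p dotZr; ring.
  apply.
  pose m' := Num.min (Num.min (s - t) (t + h - s)) (r - enorm (y - x)).
  have m'0 : 0 < m' by rewrite !lt_min !subr_gt0 tlts slt.
  exists m'; split=> // s' y'; rewrite !lt_min => /andP[/andP[k1 k2] _].
  move=> /andP[_ k3]; apply: Fmax; split=> /=; last first.
    have := enorm_le_sum y' y x; clear - k3; lra.
  move: k1 k2; rewrite !ltr_norml => /andP[k1 _] /andP[_ k2].
  by apply/andP; split; clear - k1 k2; lra.
have y1 : enorm (y - x) <= 1 := le_trans yr rle1.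
have pB := gradB s y d p tlts (lt_le_trans slt hT') y1 sd.
have h1 := subu _ _ _ _ sT sd.
have h2 := lipx y x p; have h3 := hv p.
have h4 : M * (1 + enorm p) * enorm (x - y) <= A * r.
  rewrite (enorm_distC x).
  apply: ler_pM; rewrite ?enorm_ge0 ?mulr_ge0 ?addr_ge0 ?enorm_ge0 //.
  by rewrite ler_wpM2l // lerD2l.
have h5 : 0 <= kap * (s - t) by rewrite mulr_ge0 ?subr_ge0 // ltW.
move: h1 h3; rewrite /d /c dotBr; clear - h2 h4 h5 Ar eta0; lra.
Qed.

Lemma continuous_pair (T1 T2 T3 : topologicalType) (f : T1 -> T2) (g : T1 -> T3) :
  continuous f -> continuous g -> continuous (fun w => (f w, g w)).
Proof.
move=> cf cg w.
exact: (@cvg_pair _ _ _ _ _ _ (nbhs_filter w) (nbhs_filter (f w))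
  (nbhs_filter (g w)) _ _ (cf w) (cg w)).
Qed.

(** * Scaling, time reversal and extension of solutions in time *)

Section Transformations.
Variables (R : realType) (n : nat).
Local Notation V := 'rV[R]_n.
Implicit Types (H : V -> V -> R) (u w phi : R -> V -> R).

(** Covers both changes of test function needed: a positive factor for [subdiff_scale], and the
    reversal of time with [sg = -1]. *)
Lemma C1_reparam phi (c sg tau : R) : C1 phi ->
  let psi := fun s x => c * phi (s * sg + tau) x in
  [/\ C1 psi, forall s x, dt psi s x = c * (sg * dt phi (s * sg + tau) x) &
    forall s x, gradx psi s x = c *: gradx phi (s * sg + tau) x].
Proof.
move=> [dphi [gphi [cd cg]]] psi.
have ht s x : is_derive s (1 : R) (fun s => psi s x)
    (c * (sg * dt phi (s * sg + tau) x)).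
  have df := (derivable1_diffP _ _).1 (dphi (s * sg + tau) x).
  have h : is_derive (s *: sg + tau) sg (phi ^~ x) (sg * dt phi (s * sg + tau) x).
    split; first exact: diff_derivable.
    rewrite deriveE // -[X in 'd _ _ X]mulr1 -[sg * 1]/(sg *: 1) linearZ.
    by rewrite /dt deriveE.
  exact: is_deriveZ ((is_derive_line _ _ _ _ _).1 h).
have hx i s x : is_derive x (ebasis R i) (psi s)
    (c * dxi phi i (s * sg + tau) x).
  exact: is_deriveZ (derivableP (gphi _ _ i)).
have dtE s x : dt psi s x = c * (sg * dt phi (s * sg + tau) x).
  by have [_] := ht s x.
have dxE i s x : dxi psi i s x = c * dxi phi i (s * sg + tau) x.
  by have [_] := hx i s x.
have ca : continuous (fun z : R * V => (z.1 * sg + tau, z.2)).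
  have c1 : continuous (fun z : R * V => z.1) by move=> z; exact: cvg_fst.
  have c2 : continuous (fun z : R * V => z.1 * sg + tau).
    by apply: continuous_add; [apply: continuous_mul => // |];
      exact: cst_continuous.
  have c3 : continuous (fun z : R * V => z.2) by move=> z; exact: cvg_snd.
  exact: continuous_pair c2 c3.
have comp (f : R -> V -> R) : continuous (fun z : R * V => f z.1 z.2) ->
    continuous (fun z : R * V => f (z.1 * sg + tau) z.2).
  move=> cf z.
  exact: (continuous_comp (g := fun z : R * V => f z.1 z.2) (ca z) (cf _)).
split=> //; last by move=> s x; apply/rowP => i; rewrite !mxE dxE.
split; first by move=> s x; have [] := ht s x.
split; first by move=> s x i; have [] := hx i s x.
split.
  under eq_fun do rewrite dtE.
  by do 2 (apply: continuous_mul; first exact: cst_continuous); exact: comp.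
move=> i; under eq_fun do rewrite dxE.
by apply: continuous_mul; [exact: cst_continuous | exact: (comp (dxi phi i))].
Qed.

Lemma subdiff_scale u (l : R) t x a b : 0 < l ->
  subdiff (fun s y => l * u s y) t x a b ->
  subdiff u t x (l^-1 * a) (l^-1 *: b).
Proof.
move=> l0 [phi [c1 [[e [e0 he]] [<- <-]]]].
have [c2 dE gE] := C1_reparam l^-1 1 0 c1.
eexists; split; first exact: c2.
split; last by rewrite dE gE mulr1 addr0 mul1r.
exists e; split=> // s y h1 h2; rewrite !mulr1 !addr0.
rewrite -(ler_pM2l l0) !mulrBr !mulrA divff ?gt_eqF // !mul1r.
exact: he.
Qed.

Lemma superdiff_reverse w (T : R) t x a b :
  superdiff (fun s => w (T - s)) t x a b -> superdiff w (T - t) x (- a) b.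
Proof.
move=> [phi [c1 [[e [e0 he]] [<- <-]]]].
have [c2 dE gE] := C1_reparam 1 (-1) T c1.
have tE : (T - t) * -1 + T = t by ring.
eexists; split; first exact: c2.
split; last by rewrite dE gE tE mul1r mulN1r scale1r.
exists e; split=> // s y h1 h2; rewrite !mul1r tE.
have -> : s * -1 + T = T - s by ring.
have := he (T - s) y; rewrite !subKr; apply=> //.
by rewrite (_ : T - s - t = - (s - (T - t))) ?normrN //; ring.
Qed.

Lemma subdiff_reverse w (T : R) t x a b :
  subdiff (fun s => w (T - s)) t x a b -> subdiff w (T - t) x (- a) b.
Proof.
move=> [phi [c1 [[e [e0 he]] [<- <-]]]].
have [c2 dE gE] := C1_reparam 1 (-1) T c1.
have tE : (T - t) * -1 + T = t by ring.
eexists; split; first exact: c2.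
split; last by rewrite dE gE tE mul1r mulN1r scale1r.
exists e; split=> // s y h1 h2; rewrite !mul1r tE.
have -> : s * -1 + T = T - s by ring.
have := he (T - s) y; rewrite !subKr; apply=> //.
by rewrite (_ : T - s - t = - (s - (T - t))) ?normrN //; ring.
Qed.

(** Makes a constant a supersolution for the zero Hamiltonian; only earlier times are tested. *)
Lemma subdiff_cst (c : R) t (x : V) a b : subdiff (fun _ _ => c) t x a b -> 0 <= a.
Proof.
move=> h; apply: (@ge0_of_linear R _ 1 1) => // e e0 _.
have [r r0 hr] := subdiff_expansion h e0.
have r2 : 0 < r / 2 by rewrite divr_gt0.
have := hr (t - r / 2) x; rewrite subrr enorm0 dot0r.
have tr : t - r / 2 - t = - (r / 2) by ring.
rewrite tr normrN gtr0_norm // => /(_ _ r0) h1.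
have {}h1 : c + - (r / 2) * a + 0 - e * (r / 2 + 0) <= c.
  by apply: h1; clear - r0; lra.
have : 0 <= (r / 2) * (a + e) by clear - h1; lra.
by rewrite pmulr_rge0 // mulr1.
Qed.

(* [u \o clamp T] is continuous on the whole space-time and has the same
   semidifferentials as [u] at interior times. *)
Definition clamp (T t : R) := Num.max 0 (Num.min t T).

Lemma clampE (T t : R) : 0 <= t <= T -> clamp T t = t.
Proof. by move=> /andP[t0 tT]; rewrite /clamp (min_idPl tT) (max_idPr t0). Qed.

Lemma clamp_continuous (T : R) u : 0 <= T -> cont_on (Some T) u ->
  continuous (fun z : R * V => u (clamp T z.1) z.2).
Proof.
move=> T0 cu z.
have c1 : continuous (fun z : R * V => z.1) by move=> y; exact: cvg_fst.
have c2 : continuous (fun z : R * V => z.2) by move=> y; exact: cvg_snd.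
have ccl : continuous (fun z : R * V => clamp T z.1).
  have c3 : continuous (cst 0 \max (id \min cst T) : R -> R).
    move=> s; apply: continuous_max; first exact: cst_continuous.
    by apply: continuous_min; [move=> A | exact: cst_continuous].
  by move=> y; exact: (continuous_comp (c1 y) (c3 y.1)).
have cg := continuous_pair ccl c2.
have gA (y : R * V) : closed_time (Some T) (clamp T y.1).
  by rewrite /clamp; split; rewrite ?le_max ?lexx // ge_max T0 ge_min lexx orbT.
have /subspace_continuousP/(_ (clamp T z.1, z.2) (gA z)) cw := cu.
move=> A /cw hA; have := cg z _ hA; apply: (@filterS _ (nbhs z) (nbhs_filter z)) => y /=.
by apply; exact: gA.
Qed.

End Transformations.

(** * Reduction to global functions, two-function comparison and convexity in time *)

Section Evolution.
Variables (R : realType) (n : nat).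
Local Notation V := 'rV[R]_n.
Implicit Types (H : V -> V -> R) (u w : R -> V -> R).

Lemma clamp_near (T t : R) : 0 < t < T ->
  exists2 r : R, 0 < r & forall s, `|s - t| < r -> clamp T s = s.
Proof.
move=> /andP[t0 tT]; exists (Num.min t (T - t)); first by rewrite lt_min t0 subr_gt0.
move=> s; rewrite lt_min !ltr_norml => /andP[/andP[h1 _] /andP[_ h2]].
by apply: clampE; apply/andP; split; clear - h1 h2; lra.
Qed.

Lemma superdiff_clamp u (T : R) t x a b : 0 < t < T ->
  superdiff (fun s => u (clamp T s)) t x a b <-> superdiff u t x a b.
Proof.
move=> /clamp_near[r r0 hr].
by split; apply: superdiff_local r0 _ => s y /hr ->.
Qed.

Lemma subdiff_clamp u (T : R) t x a b : 0 < t < T ->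
  subdiff (fun s => u (clamp T s)) t x a b <-> subdiff u t x a b.
Proof.
move=> /clamp_near[r r0 hr].
by split; apply: subdiff_local r0 _ => s y /hr ->.
Qed.

(** The bound is symmetric in its two momenta, so it survives the change of sign that exchanges
    convexity and concavity; comparison thus applies to the reversed equation. *)
Lemma lipschitz_momentum_opp (M : R) H : lipschitz_momentum M H ->
  lipschitz_momentum M (fun x p => - H x p).
Proof. by move=> h x p q; rewrite opprK addrC enorm_distC; exact: h. Qed.

Lemma lipschitz_position_opp (M : R) H : lipschitz_position M H ->
  lipschitz_position M (fun x p => - H x p).
Proof. by move=> h x y p; rewrite opprK addrC enorm_distC; exact: h. Qed.

Lemma forward_sol_clamp H (T : R) u : 0 < T -> forward_sol H (Some T) u ->
  [/\ continuous (fun z : R * V => u (clamp T z.1) z.2),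
    subsol H T (fun s => u (clamp T s)) & supersol H T (fun s => u (clamp T s))].
Proof.
move=> T0 [cu hu]; split; first exact: clamp_continuous (ltW T0) cu.
  move=> t x a b tT /(superdiff_clamp _ _ _ _ tT).
  by case/andP: tT => t0 tT; apply: (hu t x (conj t0 tT)).1.
move=> t x a b tT /(subdiff_clamp _ _ _ _ tT).
by case/andP: tT => t0 tT; apply: (hu t x (conj t0 tT)).2.
Qed.

Lemma backward_sol_reverse H (T : R) w : 0 < T -> backward_sol H (Some T) w ->
  [/\ continuous (fun z : R * V => w (clamp T (T - z.1)) z.2),
    subsol (fun x p => - H x p) T (fun s => w (clamp T (T - s))) &
    supersol (fun x p => - H x p) T (fun s => w (clamp T (T - s)))].
Proof.
move=> T0 [cw hw].
have rev t : 0 < t < T -> 0 < T - t < T.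
  by move=> /andP[t0 tT]; rewrite subr_gt0 tT ltrBlDr ltrDl t0.
split.
- have c1 : continuous (fun z : R * V => z.1) by move=> y; exact: cvg_fst.
  have c2 : continuous (fun z : R * V => z.2) by move=> y; exact: cvg_snd.
  have c3 : continuous (fun z : R * V => T - z.1).
    by apply: continuous_sub => //; exact: cst_continuous.
  have c4 := continuous_pair c3 c2.
  have c5 := clamp_continuous (ltW T0) cw.
  by move=> z; exact: (continuous_comp (c4 z) (c5 _)).
- move=> t x a b /rev tT /(@superdiff_reverse _ _ (fun s => w (clamp T s))).
  move=> /(superdiff_clamp _ _ _ _ tT); case/andP: tT => t0 tT.
  by move=> /(hw _ x (conj t0 tT)).1; rewrite addrC subr_ge0 subr_le0.
- move=> t x a b /rev tT /(@subdiff_reverse _ _ (fun s => w (clamp T s))).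
  move=> /(subdiff_clamp _ _ _ _ tT); case/andP: tT => t0 tT.
  by move=> /(hw _ x (conj t0 tT)).2; rewrite addrC subr_le0 subr_ge0.
Qed.

(* [comparison] with weights 1 and 0: the second function is irrelevant. *)
Lemma comparison_single H (M T : R) u w : 0 <= M -> lipschitz_momentum M H ->
  lipschitz_position M H -> subsol H T u -> supersol H T w ->
  continuous (fun z : R * V => u z.1 z.2) ->
  continuous (fun z : R * V => w z.1 z.2) ->
  (forall x, u 0 x <= w 0 x) -> forall t x, 0 <= t <= T -> u t x <= w t x.
Proof.
move=> M0 lp lx su sw cu cw init t x tT.
have := @comparison R n H (fun _ _ => 0) H w (fun _ _ => 0) u M T 1 0 M0
  ler01 (lexx 0) (addr0 1) lp _ lx _ sw _ su cw _ cu _ t x x tT.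
rewrite scale1r scale0r !addr0; apply.
- by move=> y p q; rewrite subrr !mulr_ge0 ?addr_ge0 ?enorm_ge0.
- by move=> y z p; rewrite !scale1r scale0r !addr0.
- by move=> s y a b _ /subdiff_cst; rewrite addr0.
- exact: cst_continuous.
- by move=> y z; rewrite scale1r scale0r !addr0.
Qed.

(** [k * u] solves the equation with Hamiltonian [k * H x (k^-1 *: p)], which has the same Lipschitz
    constant in [p]. At momenta [l *: p] and [(1 - l) *: p] the two scaled Hamiltonians add up to a
    convex combination of [H x p] and [H y p], and concavity in position is exactly [K12H]. *)
Lemma convexity_preserved H (M T : R) u : 0 <= M -> lipschitz_momentum M H ->
  lipschitz_position M H -> (forall p, concave_fun (fun x => H x p)) ->
  subsol H T u -> supersol H T u -> continuous (fun z : R * V => u z.1 z.2) ->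
  convex_fun (u 0) -> forall t, 0 <= t <= T -> convex_fun (u t).
Proof.
move=> M0 lp lx cH su hu cu cv0 t tT x y l.
rewrite le_eqVlt => /predU1P[<- _|l0].
  by rewrite scale0r subr0 scale1r mul0r mul1r !add0r.
rewrite le_eqVlt => /predU1P[->|l1].
  by rewrite subrr scale0r scale1r mul0r mul1r !addr0.
have m0 : 0 < 1 - l by rewrite subr_gt0.
have lpK k : 0 < k -> lipschitz_momentum M (fun x p => k * H x (k^-1 *: p)).
  move=> k0 z p q; rewrite -mulrBr -ler_pdivlMl // mulrCA.
  apply: le_trans (lp _ _ _) _.
  by rewrite -scalerBr enormZ gtr0_norm ?invr_gt0.
have supK k : 0 < k ->
    supersol (fun x p => k * H x (k^-1 *: p)) T (fun t x => k * u t x).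
  move=> k0 s z a b sT /(subdiff_scale k0)/(hu _ _ _ _ sT).
  by rewrite -(pmulr_rge0 _ k0) mulrDr mulrA divff ?gt_eqF // mul1r.
have cK k : continuous (fun z : R * V => k * u z.1 z.2).
  by apply: continuous_mul; [exact: cst_continuous | exact: cu].
apply: (@comparison R n _ _ H (fun t x => l * u t x)
  (fun t x => (1 - l) * u t x) u M T l (1 - l) M0 (ltW l0) (ltW m0) _
  (lpK _ l0) (lpK _ m0) lx _ (supK _ l0) (supK _ m0) su (cK l) (cK (1 - l)) cu)
  => //.
- by rewrite addrC subrK.
- move=> z z' p; rewrite !scalerA !mulVf ?gt_eqF // !scale1r.
  by apply: cH; exact: ltW.
- by move=> z z'; apply: cv0; exact: ltW.
Qed.

End Evolution.

(** * Bilaterality on every horizon, and recovery of the initial function *)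

Theorem theorem5p8 (R : realType) (n : nat) (H : 'rV[R]_n -> 'rV[R]_n -> R)
  (M : R) :
  (forall x, convex_fun (H x)) ->
  (forall p, concave_fun (fun x => H x p)) ->
  0 <= M ->
  (forall x p, `|H x p| <= M * (1 + enorm x) * (1 + enorm p)) ->
  forall g0 : 'rV[R]_n -> R, convex_fun g0 ->
    (forall u : R -> 'rV[R]_n -> R,
        forward_sol H None u -> (forall x, u 0 x = g0 x) ->
        bilateral_sol H None u) /\
    (forall T : R, 0 < T -> reconstructible H g0 T).
Proof.
move=> cvH ccH M0 growth g0 cvg0.
have lp : lipschitz_momentum M H.
  move=> x; apply: convex_growth_lipschitz => //.
  by rewrite mulr_ge0 // addr_ge0 ?enorm_ge0.
have lx : lipschitz_position M H.
  move=> x y p; apply: (@concave_growth_lipschitz R n (fun x => H x p)) => //.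
    by rewrite mulr_ge0 // addr_ge0 ?enorm_ge0.
  by move=> z; rewrite mulrAC; exact: growth.
have bil (T : R) u : 0 < T -> forward_sol H (Some T) u ->
    (forall x, u 0 x = g0 x) -> forall t x, 0 < t < T ->
    (forall a b, superdiff u t x a b -> 0 <= a + H x b) /\
    (forall a b, subdiff u t x a b -> a + H x b <= 0).
  move=> T0 hu u0 t x tT.
  have [cu su pu] := forward_sol_clamp T0 hu.
  have cv s : 0 <= s <= T -> convex_fun (u (clamp T s)).
    apply: (convexity_preserved M0 lp lx ccH su pu cu).
    rewrite clampE ?lexx ?ltW // => y z l l0 l1; rewrite !u0; exact: cvg0.
  have cv' s : 0 < s < T -> convex_fun (u (clamp T s)).
    by move=> /andP[s0 sT]; apply: cv; rewrite !ltW.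
  split=> a b.
    move=> /(superdiff_clamp u x a b tT).2 h.
    exact: (superdiff_backward M0 lp lx pu cu (cv' t tT) tT h).
  move=> /(subdiff_clamp u x a b tT).2 h.
  exact: (subdiff_backward M0 lp lx (cvH x) su cu cv' tT h).
split=> [u [cu hu] u0|T T0 u w hu u0 hw wT x].
  split=> //; split=> // t x [t0 _].
  (* The conditions are local in time, so any finite horizon beyond [t] will do. *)
  have t1 : 0 < t + 1 by rewrite addr_gt0.
  have tt1 : 0 < t < t + 1 by rewrite t0 ltrDl ltr01.
  apply: (bil _ u t1 _ u0 t x tt1).
  split=> [|s y [s0 _]]; last by apply: hu.
  by apply: continuous_subspaceW cu => z [z0 _].
(* Thus [u] and [w] are backward solutions with the same values at [T], and equality at time 0 is a
   matter of uniqueness. *)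
have bu : backward_sol H (Some T) u.
  split; first by case: hu.
  by move=> t y [t0 tT]; apply: (bil T) => //; rewrite t0.
have [cu su pu] := backward_sol_reverse T0 bu.
have [cw sw pw] := backward_sol_reverse T0 hw.
have lp' := lipschitz_momentum_opp lp.
have lx' := lipschitz_position_opp lx.
have E0 : clamp T (T - 0) = T by rewrite subr0 clampE // lexx ltW.
have ET : clamp T (T - T) = 0 by rewrite subrr clampE // lexx ltW.
have TT : 0 <= T <= T by rewrite lexx ltW.
rewrite -u0; apply/eqP; rewrite eq_le; apply/andP; split; rewrite -ET.
  apply: (comparison_single M0 lp' lx' sw pu cw cu _ x TT) => y.
  by rewrite E0 wT.
apply: (comparison_single M0 lp' lx' su pw cu cw _ x TT) => y.
by rewrite E0 wT.
Qed.
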